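(* Assume: (a) $c\ge 1$ and $\alpha\ge1$ are fixed constants, and $(n,p,k)\to\infty$ with $p/n^{\alpha}\to c$; (b) the signal strength $\beta>0$, either fixed or growing with $n,p$, satisfies $\beta\le\sqrt{p/n}$; (c) the sparsity level $k$ satisfies $k\ge 2p/\sqrt n$, and $k/p\to0$. Then there exists $\varepsilon=\varepsilon(n)\to0$ such that, if $X$ is a solution of the semidefinite program $$\operatorname{argmax}\{\langle\hat\Sigma,X\rangle : X\in\mathcal S^p_+,\ \operatorname{tr}(X)=1,\ \|X\|_S\le k\},$$ $\lambda_1$ is the largest eigenvalue of $X$, and $\hat{\mathbf z}$ is a leading unit-length eigenvector of $X$ (i.e. an eigenvector for $\lambda_1$), then with probability tending to one as $(n,p,k)\to\infty$, $$|\langle\hat{\mathbf z},\mathbf z\rangle|^2\le\frac{23}{\lambda_1}\sqrt{\frac np}\,\bigl(1+\sqrt\beta\bigr)+\frac{\varepsilon}{\lambda_1}.$$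
   Context: Single-spike model: the spike $\mathbf z\in\mathbb R^p$ is a deterministic unit-length vector with exactly $k$ nonzero entries, each equal to $+1/\sqrt k$ or $-1/\sqrt k$. The samples are $\mathbf x_i=\sqrt{\beta}\,u_i\,\mathbf z+\boldsymbol\xi_i$ for $i=1,\dots,n$, where $\beta>0$ is the signal strength, $u_i\sim N(0,1)$, the vectors $\boldsymbol\xi_i\in\mathbb R^p$ have i.i.d. $N(0,1)$ entries, and all the $u_i$'s and $\boldsymbol\xi_i$'s are mutually independent. The sample covariance matrix is $\hat\Sigma=\frac1n\sum_{i=1}^n\mathbf x_i\mathbf x_i^T$. For $p\times p$ real matrices, $\langle A,B\rangle=\sum_{i,j}A_{ij}B_{ij}=\operatorname{tr}(A^TB)$, $\|X\|_S=\sum_{i,j}|X_{ij}|$, and $\mathcal S^p_+$ is the cone of symmetric positive semidefinite $p\times p$ matrices. The parameter $k$ in the semidefinite program equals the sparsity of the spike. Asymptotic statements refer to sequences $p=p(n)$, $k=k(n)$ with $n\to\infty$, $p\to\infty$, $k\to\infty$. *)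

(* Defs.v *)
From HB Require Import structures.
From mathcomp Require Import all_boot all_order all_algebra.
From mathcomp Require Import all_classical all_reals all_analysis.

Set Implicit Arguments.
Unset Strict Implicit.
Unset Printing Implicit Defensive.

Import Order.TTheory GRing.Theory Num.Theory.
Import numFieldNormedType.Exports.

Local Open Scope classical_set_scope.
Local Open Scope ring_scope.

Section Matrices.
Context {R : realType}.

(* On column vectors this is the Euclidean inner product. *)
Definition mxdot m n (A B : 'M[R]_(m, n)) : R := \sum_i \sum_j A i j * B i j.

Definition mxnormS m n (A : 'M[R]_(m, n)) : R := \sum_i \sum_j `|A i j|.

Definition possemidef p (A : 'M[R]_p) : Prop :=
  A^T = A /\ forall v : 'cV[R]_p, 0 <= (v^T *m A *m v) 0 0.

Definition largest_eigenvalue p (A : 'M[R]_p) (l : R) : Prop :=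
  eigenvalue A l /\ forall a : R, eigenvalue A a -> a <= l.

Definition unit_vector p (v : 'cV[R]_p) : Prop := mxdot v v = 1.

Definition sdp_feasible p (k : nat) (X : 'M[R]_p) : Prop :=
  [/\ possemidef X, \tr X = 1 & mxnormS X <= k%:R].

Definition sdp_solution p (S : 'M[R]_p) (k : nat) (X : 'M[R]_p) : Prop :=
  sdp_feasible k X /\
  forall Y : 'M[R]_p, sdp_feasible k Y -> mxdot S Y <= mxdot S X.

Definition sparse_spike p (k : nat) (z : 'cV[R]_p) : Prop :=
  [/\ unit_vector z,
      #|[set i | z i 0 != 0]%SET| = k &
      forall i, z i 0 != 0 ->
        z i 0 = 1 / Num.sqrt k%:R \/ z i 0 = - (1 / Num.sqrt k%:R)].

Definition sample_cov n p (x : 'I_n -> 'cV[R]_p) : 'M[R]_p :=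
  n%:R^-1 *: \sum_i x i *m (x i)^T.

End Matrices.

Section Probability.
Context d (T : measurableType d) (R : realType) (P : probability T R).

Definition mutually_independent (I : finType) (X : I -> {RV P >-> R}) : Prop :=
  forall (J : {set I}) (A : I -> set R), (forall j, measurable (A j)) ->
    P (\bigcap_(j in [set` J]) (X j @^-1` A j)) =
    (\prod_(j in J) P (X j @^-1` A j))%E.

(* [normal_prob] is a measure only on measurable sets, so the two laws are
   compared there. *)
Definition standard_normal (X : {RV P >-> R}) : Prop :=
  forall A : set R, measurable A -> distribution P X A = normal_prob 0 1 A.

Definition gaussian_inputs n p (u : 'I_n -> {RV P >-> R})
    (xi : 'I_n -> 'I_p -> {RV P >-> R}) : Prop :=
  [/\ forall i, standard_normal (u i),
      forall i j, standard_normal (xi i j) &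
      mutually_independent (fun a : 'I_n + 'I_n * 'I_p =>
        match a with inl i => u i | inr ij => xi ij.1 ij.2 end)].

Definition spiked_sample n p (beta : R) (z : 'cV[R]_p)
    (u : 'I_n -> {RV P >-> R}) (xi : 'I_n -> 'I_p -> {RV P >-> R})
    (w : T) (i : 'I_n) : 'cV[R]_p :=
  (Num.sqrt beta * u i w) *: z + \col_j xi i j w.

Definition spiked_cov n p (beta : R) (z : 'cV[R]_p)
    (u : 'I_n -> {RV P >-> R}) (xi : 'I_n -> 'I_p -> {RV P >-> R})
    (w : T) : 'M[R]_p :=
  sample_cov (spiked_sample beta z u xi w).

End Probability.

(* The events [G n] may quantify over uncountably many matrices and are not
   assumed measurable: what is required is that they contain measurable events
   whose probabilities tend to one (inner probability tending to one). *)
Definition with_probability_tending_to_one (R : realType)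
    (d : nat -> measure_display) (T : forall n, measurableType (d n))
    (P : forall n, probability (T n) R) (G : forall n, set (T n)) : Prop :=
  exists E : forall n, set (T n),
    [/\ forall n, measurable (E n),
        forall n, E n `<=` G n &
        P n (E n) @[n --> \oo] --> 1%E].

(* Main.v *)
Require Import Defs.
From HB Require Import structures.
From mathcomp Require Import all_boot all_order all_algebra.
From mathcomp Require Import all_classical all_reals all_analysis.
From mathcomp Require Import measurable_realfun zify ring lra complex.

(* Write g = sqrt(n/p), Xi for the p x n noise matrix and t = z^T X z.  As X is
   positive semidefinite, lambda1 <zhat, z>^2 <= t, so it suffices to show
   t <= 23 g (1 + sqrt beta), which is trivial unless g <= 1/23.
   The matrix Xi Xi^T / |Xi|_F^2 is feasible, because its l1 norm is at most p
   times its Frobenius norm, and its objective value is about p/n.  Conversely,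
   splitting the factors of X along z and its orthogonal complement bounds the
   objective value of X by
   (sqrt (t |x z|^2 / n) + sqrt ((1 - t) |Xi|_op^2 / n))^2.
   Comparing the two bounds t as soon as |Xi|_op^2 <= p (1 + 9 g); one may take
   epsilon = 0.
   The operator norm is controlled by a union bound over the integer vectors m
   with 0 < |m|^2 <= 4n, of which there are at most 48^n: any vector of norm
   sqrt n is rounded to such an m, coordinate by coordinate, losing only a term
   in the diagonal of Xi^T Xi. *)

Set Implicit Arguments.
Unset Strict Implicit.
Unset Printing Implicit Defensive.

Import Order.TTheory GRing.Theory Num.Theory.
Import numFieldNormedType.Exports.

Local Open Scope classical_set_scope.
Local Open Scope ring_scope.

(** * Integration against densities and independence *)

Section Density.
Context d1 d2 (T1 : measurableType d1) (T2 : measurableType d2) (R : realType).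
Import HBNNSimple.

(** The hypothesis is the claim for indicators; linearity gives simple functions and monotone
    convergence the rest. Keeping [phi], [g] and [c] general lets it serve for normal densities, for
    independence, and for changing the structure carried by the reals. *)
Lemma ge0_integral_density (mu : {measure set T1 -> \bar R})
    (nu : {measure set T2 -> \bar R}) (phi : T1 -> T2) (g : T1 -> R) (c : R) :
  measurable_fun setT phi -> measurable_fun setT g -> (forall x, 0 <= g x) ->
  0 <= c ->
  (forall A, measurable A ->
    (\int[mu]_x (\1_A (phi x) * g x)%:E = c%:E * nu A)%E) ->
  forall f : T2 -> \bar R, measurable_fun setT f -> (forall x, 0 <= f x)%E ->
  (\int[mu]_x (f (phi x) * (g x)%:E) = c%:E * \int[nu]_x f x)%E.
Proof.
move=> mphi mg g0 c0 H f mf f0.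
pose h := nnsfun_approx measurableT mf.
have hcvg x : (h n x)%:E @[n --> \oo] --> f x.
  exact: cvg_nnsfun_approx.
have hnd x : nondecreasing_seq (fun n => h n x).
  by move=> a b ab; exact/lefP/nd_nnsfun_approx.
have -> : (\int[nu]_x f x = limn (fun n => \int[nu]_x (h n x)%:E))%E.
  under eq_integral => x _ do rewrite -(cvg_lim (@ereal_hausdorff _) (hcvg x)).
  apply: monotone_convergence => //.
  - by move=> n; apply/measurable_EFinP.
  - by move=> n x _; rewrite lee_fin.
  - by move=> x _ a b ab; rewrite lee_fin; exact: hnd.
have -> : (\int[mu]_x (f (phi x) * (g x)%:E) =
    limn (fun n => \int[mu]_x ((h n (phi x))%:E * (g x)%:E)))%E.
  have fg x : (f (phi x) * (g x)%:E)%E =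
     lim (((h n (phi x))%:E * (g x)%:E)%E @[n --> \oo]).
    by apply/esym/cvg_lim => //; apply: cvgeZr => //; exact: hcvg.
  under eq_integral => x _ do rewrite fg.
  apply: monotone_convergence => //.
  - move=> n; apply: emeasurable_funM; apply/measurable_EFinP => //.
    exact: measurableT_comp.
  - by move=> n x _; rewrite -EFinM lee_fin mulr_ge0.
  - by move=> x _ a b ab; rewrite -!EFinM lee_fin ler_wpM2r//; exact: hnd.
rewrite -limeMl//; last first.
  apply: ereal_nondecreasing_is_cvgn => a b ab; apply: ge0_le_integral => //.
  - by move=> x _; rewrite lee_fin.
  - by apply/measurable_EFinP.
  - by apply/measurable_EFinP.
  - by move=> x _; rewrite lee_fin; exact: hnd.
congr (limn _); apply/funext => n.
have hE x : (h n x)%:E = (\sum_(y \in range (h n)) (y * \1_(h n @^-1` [set y]) x)%:E)%E.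
  by rewrite fsumEFin// -fimfunE.
under [in RHS]eq_integral => x _ do rewrite hE.
have y0 y : y \in range (h n) -> 0 <= y by rewrite inE => -[t _ <-].
rewrite [in RHS]ge0_integral_fsum//; last first.
- by move=> r x _; exact: nnfun_muleindic_ge0.
- by move=> y; apply/measurable_EFinP; exact: measurable_funM.
under eq_integral => x _.
  rewrite hE ge0_mule_fsuml => [|y]; last exact: nnfun_muleindic_ge0.
  over.
rewrite ge0_integral_fsum//; last 2 first.
- move=> y; apply: emeasurable_funM => //; apply/measurable_EFinP => //.
  apply: measurable_funM => //.
  by apply: measurableT_comp => //; exact: measurable_indic.
- by move=> m y Ey; rewrite mule_ge0 ?lee_fin// -lee_fin nnfun_muleindic_ge0.
rewrite ge0_mule_fsumr; last first.
  by move=> y; apply: integral_ge0 => x _; exact: nnfun_muleindic_ge0.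
apply: eq_fsbigr => r rhn.
under eq_integral => x _ do rewrite EFinM -muleA.
under [in RHS]eq_integral => x _ do rewrite EFinM.
have mI : measurable_fun [set: T2] (\1_(h n @^-1` [set r]) : T2 -> R) by [].
rewrite ge0_integralZl//; last 2 first.
- by apply/measurable_EFinP.
- by rewrite lee_fin y0.
rewrite [LHS]ge0_integralZl//; last 3 first.
- apply: emeasurable_funM; apply/measurable_EFinP => //.
  exact: measurableT_comp.
- by move=> x _; rewrite -EFinM lee_fin mulr_ge0.
- by rewrite lee_fin y0.
rewrite H//.
by rewrite integral_indic// setIT muleCA.
Qed.

End Density.

(** * Integrals of products of independent variables *)

Section Independence.
Context d (T : measurableType d) (R : realType) (P : probability T R).

(** Induction on the list [s] of indices whose factor may fail to be an indicator. For empty [s] the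
    claim is independence itself; each step frees one factor, the product of the others serving as a
    density. *)
Let integral_prod_indep_in (I : finType) (X : I -> {RV P >-> R})
    (hX : mutually_independent X) (s : seq I) (F : I -> R -> R) (r : I -> R) :
  (forall a, measurable_fun setT (F a)) -> (forall a x, 0 <= F a x) ->
  (forall a, \int[P]_w (F a (X a w))%:E = (r a)%:E)%E ->
  (forall a, a \notin s -> exists2 A, measurable A & F a = \1_A) ->
  (\int[P]_w (\prod_a F a (X a w))%:E = (\prod_a r a)%:E)%E.
Proof.
have mX a A : measurable A -> measurable (X a @^-1` A).
  by move=> mA; rewrite -[_ @^-1` _]setTI; apply: measurable_funP.
have indicX a A : measurable A ->
    (\int[P]_w (\1_A (X a w))%:E = P (X a @^-1` A))%E.
  move=> mA; transitivity (\int[P]_w (\1_(X a @^-1` A) w)%:E)%E => [//|].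
  by rewrite integral_indic ?setIT//; exact: mX.
elim: s F r => [|b s IH] F r mF F0 rE Fs.
  have /choice[A AP] : forall a, exists A, measurable A /\ F a = \1_A.
    by move=> a; have [//|A mA FA] := Fs a; exists A.
  have -> : (fun w => (\prod_a F a (X a w))%:E) =
      (fun w => (\1_(\bigcap_(j in [set` [set: I]%SET]) (X j @^-1` A j)) w)%:E).
    apply/funext => w; congr EFin.
    rewrite indicE; case: (boolP (w \in _)) => [|].
      rewrite inE => Aw; rewrite big1// => a _.
      by rewrite (AP a).2 indicE mem_set//; apply: Aw => /=; rewrite inE.
    move=> /negP nA; apply/eqP; rewrite prodf_seq_eq0.
    apply: contrapT => /negP /hasPn nh.
    apply: nA; rewrite inE => a _ /=.
    have := nh a (mem_index_enum a).
    rewrite (AP a).2 indicE andTb; case: (boolP (X a w \in A a)) => //=.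
      by rewrite inE.
    by rewrite eqxx.
  have mA a : measurable (X a @^-1` A a).
    by apply: mX; exact: (AP a).1.
  rewrite integral_indic//; last first.
    by apply: fin_bigcap_measurable.
  rewrite setIT; transitivity (\prod_(a in [set: I]%SET) P (X a @^-1` A a))%E.
    by apply: hX => a; exact: (AP a).1.
  rewrite -prodEFin; apply: eq_big => [a|a _]; first by rewrite inE.
  by rewrite -rE (AP a).2 indicX//; exact: (AP a).1.
pose G w := \prod_(a | a != b) F a (X a w).
pose c := \prod_(a | a != b) r a.
have r0 a : 0 <= r a by rewrite -lee_fin -rE integral_ge0// => x _; rewrite lee_fin.
have c0 : 0 <= c by apply: prodr_ge0.
have key := @ge0_integral_density _ _ T _ R P (distribution P (X b)) (X b) G c.
rewrite (bigD1 b)//= -/c mulrC EFinM -rE.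
have mFX a : measurable_fun setT (fun w => F a (X a w)).
  by apply: measurableT_comp.
transitivity (c%:E * \int[distribution P (X b)]_x (F b x)%:E)%E; last first.
  congr (_ * _)%E; rewrite ge0_integral_distribution//.
    by apply/measurable_EFinP.
  by move=> x; rewrite lee_fin.
transitivity (\int[P]_w ((F b (X b w))%:E * (G w)%:E))%E.
  by apply: eq_integral => w _; rewrite (bigD1 b)//= EFinM.
apply: (key _ _ _ _ _ (fun x => (F b x)%:E)) => //.
- rewrite /G; under eq_fun do rewrite big_mkcond/=.
  apply: measurable_prod => a _ /=; by case: (a != b).
- by move=> x; apply: prodr_ge0.
- move=> A mA.
  (* With [\1_A] in place of [F b], the index [b] leaves the list, so the induction hypothesis gives
     the density relation. *)
  pose F' a := if a == b then \1_A else F a.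
  pose r' a := if a == b then fine (distribution P (X b) A) else r a.
  transitivity (\int[P]_w (\prod_a F' a (X a w))%:E)%E.
    apply: eq_integral => w _; rewrite (bigD1 b)//= /F' eqxx; congr (_ * _)%:E.
    by apply: eq_bigr => a /negbTE ->.
  rewrite (IH F' r').
  + rewrite (bigD1 b)//= /r' eqxx mulrC EFinM; congr (_ * _)%E.
      by congr EFin; apply: eq_bigr => a /negbTE ->.
    by rewrite fineK// fin_num_measure.
  + by move=> a; rewrite /F'; case: ifP.
  + by move=> a x; rewrite /F'; case: ifP.
  + move=> a; rewrite /F' /r'; case: eqP => [->|//].
    rewrite fineK ?fin_num_measure//.
    exact: indicX.
  + move=> a; rewrite /F'; case: eqP => [_ _|/eqP ab as_]; first by exists A.
    by apply: Fs; rewrite inE negb_or ab.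
- by apply/measurable_EFinP.
- by move=> x; rewrite lee_fin.
Qed.

Lemma ge0_integral_prod_independent (I : finType) (X : I -> {RV P >-> R})
    (F : I -> R -> R) (r : I -> R) :
  mutually_independent X ->
  (forall a, measurable_fun setT (F a)) -> (forall a x, 0 <= F a x) ->
  (forall a, \int[P]_w (F a (X a w))%:E = (r a)%:E)%E ->
  (\int[P]_w (\prod_a F a (X a w))%:E = (\prod_a r a)%:E)%E.
Proof.
move=> hX mF F0 rE; apply: (integral_prod_indep_in hX (s := enum I)) => //.
by move=> a; rewrite mem_enum.
Qed.

End Independence.

(** * Gaussian integrals and tail bounds *)

Section Gaussian_integrals.
Context {R : realType}.
Local Notation gauss := (normal_prob (0 : R) 1).

Lemma ge0_integral_normal_prob (m s : R) (f : R -> R) :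
  measurable_fun setT f -> (forall x, 0 <= f x) ->
  (\int[normal_prob m s]_x (f x)%:E =
   \int[lebesgue_measure]_x (f x * normal_pdf m s x)%:E)%E.
Proof.
move=> mf f0; apply/esym; rewrite -[RHS]mul1e.
under eq_integral => x _ do rewrite EFinM.
apply: (@ge0_integral_density _ _ _ _ R lebesgue_measure (normal_prob m s)
          (fun x => x) (normal_pdf m s) 1 _ _ _ _ _ (fun x => (f x)%:E)) => //.
- exact: measurable_normal_pdf.
- exact: normal_pdf_ge0.
- move=> A mA; rewrite mul1e /normal_prob [RHS]integral_mkcond.
  by apply: eq_integral => x _; rewrite epatch_indic -EFinM mulrC.
- by apply/measurable_EFinP.
Qed.

Let integral_scaled_pdf (k m s : R) : 0 <= k ->
  (\int[lebesgue_measure]_x (k * normal_pdf m s x)%:E = k%:E)%E.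
Proof.
move=> k0; under eq_integral => x _ do rewrite EFinM.
rewrite ge0_integralZl//; last 2 first.
- by apply/measurable_EFinP; exact: measurable_normal_pdf.
- by move=> x _; rewrite lee_fin normal_pdf_ge0.
by rewrite integral_normal_pdf mule1.
Qed.

(** Completing the square: the integrand is [expR (c ^+ 2 / 2)] times the density of the normal law
    of mean [c] and variance 1. *)
Lemma integral_normal_exp_linear (c : R) :
  (\int[gauss]_x (expR (c * x))%:E = (expR (c ^+ 2 / 2))%:E)%E.
Proof.
rewrite ge0_integral_normal_prob; last 2 first.
- by apply: measurableT_comp => //; exact: measurable_funM.
- by move=> x; exact: expR_ge0.
transitivity (\int[lebesgue_measure]_x
    (expR (c ^+ 2 / 2) * normal_pdf c 1 x)%:E)%E; last first.
  by apply: integral_scaled_pdf; exact: expR_ge0.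
apply: eq_integral => x _; congr EFin.
rewrite !normal_pdfE ?oner_neq0// !mulrA ![_ * normal_peak _]mulrC -!mulrA.
congr (_ * _); rewrite /normal_fun -!expRD; congr expR; by field.
Qed.

(** The integrand is a multiple of the centred normal density of variance [(1 - 2 * a)^-1]. *)
Lemma integral_normal_exp_square (a : R) : a < 1 / 2 ->
  (\int[gauss]_x (expR (a * x ^+ 2))%:E = (Num.sqrt (1 - 2 * a))^-1%:E)%E.
Proof.
move=> a1; rewrite ge0_integral_normal_prob; last 2 first.
- by apply: measurableT_comp => //; apply: measurable_funM => //;
    exact: measurable_funX.
- by move=> x; exact: expR_ge0.
set s := (Num.sqrt _)^-1.
have b0 : 0 < 1 - 2 * a by lra.
have s0 : 0 < s by rewrite invr_gt0 sqrtr_gt0.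
transitivity (\int[lebesgue_measure]_x (s * normal_pdf 0 s x)%:E)%E; last first.
  by apply: integral_scaled_pdf; exact: ltW.
apply: eq_integral => x _; congr EFin.
rewrite !normal_pdfE ?oner_neq0 ?gt_eqF//.
have -> : normal_peak 1 = s * normal_peak s.
  rewrite /normal_peak expr1n mul1r -mulrnAr sqrtrM ?sqr_ge0// sqrtr_sqr.
  by rewrite (gtr0_norm s0) invfM mulrA divff ?mul1r// gt_eqF.
rewrite mulrCA -!mulrA; congr (_ * (_ * _)).
rewrite /normal_fun -expRD; congr expR.
have -> : s ^+ 2 = (1 - 2 * a)^-1 by rewrite /s exprVn sqr_sqrtr// ltW.
by field; rewrite gt_eqF.
Qed.

End Gaussian_integrals.

Section Gaussian_family.
Context d (T : measurableType d) (R : realType) (P : probability T R).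

Lemma mutually_independent_comp (I K : finType) (f : K -> I)
    (X : I -> {RV P >-> R}) :
  injective f -> mutually_independent X ->
  mutually_independent (fun k => X (f k)).
Proof.
move=> finj hX J A mA.
(* Outside the range of [f] only measurability matters, since [hX] is used on the image of [J]. *)
pose A' i := if [pick k | f k == i] is Some k then A k else setT.
have A'f k : A' (f k) = A k.
  rewrite /A'; case: pickP => [k' /eqP /finj -> //|/(_ k)].
  by rewrite eqxx.
have mA' i : measurable (A' i) by rewrite /A'; case: pickP.
have := hX (f @: J)%SET A' mA'.
rewrite big_imset/=; last by move=> ? ? _ _; exact: finj.
under eq_bigr do rewrite A'f.
move=> <-; congr (P _); apply/seteqP; split => w /=.
- move=> H i /= /imsetP[k kJ ->]; rewrite A'f; exact: H.
- move=> H k /= kJ; have := H (f k); rewrite /= A'f; apply.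
  by apply/imsetP; exists k.
Qed.

Lemma ge0_integral_standard_normal (X : {RV P >-> R}) (f : R -> R) :
  standard_normal X -> measurable_fun setT f -> (forall x, 0 <= f x) ->
  (\int[P]_w (f (X w))%:E = \int[normal_prob 0 1]_x (f x)%:E)%E.
Proof.
move=> hX mf f0.
transitivity (\int[distribution P X]_x (f x)%:E)%E.
  rewrite ge0_integral_distribution//; by apply/measurable_EFinP.
(* [normal_prob] lives on [measurableTypeR R], whose structure is convertible to
   but syntactically different from the canonical one of [R]. *)
pose id' : measurableTypeR R -> R := idfun.
have mid' : measurable_fun setT id' by exact: measurable_id.
have := @ge0_integral_density _ _ _ _ R (normal_prob 0 1) (distribution P X)
  id' (fun=> 1) 1 mid' _ _ _ _ (fun x => (f x)%:E).
rewrite mul1e => <- //.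
- by apply: eq_integral => x _; rewrite mule1.
- move=> A mA; rewrite mul1e; transitivity (normal_prob 0 1 A); last first.
    by apply/esym/hX.
  under eq_integral => x _ do rewrite mulr1.
  by rewrite integral_indic ?setIT.
- by apply/measurable_EFinP.
Qed.

Variables (I J : finType) (Y : I -> J -> {RV P >-> R}).
Hypothesis Yindep : mutually_independent (fun a : I * J => Y a.1 a.2).
Hypothesis Ynormal : forall i j, standard_normal (Y i j).

Let V (v : J -> R) := \sum_j v j ^+ 2.
Let L (v : J -> R) i w := \sum_j v j * Y i j w.

Let measurable_L v i : measurable_fun setT (L v i).
Proof. by apply: measurable_sum => j; exact: measurable_funM. Qed.

Let integral_exp_linear (v : J -> R) (c : I -> R) :
  (\int[P]_w (\prod_i expR (c i * L v i w))%:E =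
   (\prod_i expR (c i ^+ 2 * V v / 2))%:E)%E.
Proof.
transitivity (\int[P]_w (\prod_(a : I * J)
    expR (c a.1 * v a.2 * Y a.1 a.2 w))%:E)%E.
  apply: eq_integral => w _; congr EFin.
  rewrite -(pair_bigA _ (fun i j => expR (c i * v j * Y i j w)))/=.
  apply: eq_bigr => i _; rewrite -expR_sum mulr_sumr; congr expR.
  by apply: eq_bigr => j _; rewrite mulrA.
rewrite (ge0_integral_prod_independent
  (F := fun (a : I * J) x => expR (c a.1 * v a.2 * x))
  (r := fun a => expR ((c a.1 * v a.2) ^+ 2 / 2)) Yindep).
- congr EFin; rewrite -(pair_bigA _ (fun i j => expR ((c i * v j) ^+ 2 / 2)))/=.
  apply: eq_bigr => i _; rewrite -expR_sum; congr expR.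
  rewrite /V mulr_sumr mulr_suml; apply: eq_bigr => j _.
  by rewrite exprMn.
- by move=> a; apply: measurableT_comp => //; exact: measurable_funM.
- by move=> a x; exact: expR_ge0.
- move=> a; rewrite (ge0_integral_standard_normal
     (f := fun x => expR (c a.1 * v a.2 * x)))//.
  + exact: integral_normal_exp_linear.
  + by apply: measurableT_comp => //; exact: measurable_funM.
Qed.

(* Each square is linearised by
   [expR (l * y ^+ 2) = E (expR (Num.sqrt (2 * l) * y * g))], [g] standard
   normal and independent of the data. *)
Lemma integral_exp_sum_square (v : J -> R) (l : R) : 0 <= l ->
  2 * l * (\sum_j v j ^+ 2) < 1 ->
  (\int[P]_w (expR (l * \sum_i (\sum_j v j * Y i j w) ^+ 2))%:E =
   (((Num.sqrt (1 - 2 * l * \sum_j v j ^+ 2))^-1) ^+ #|I|)%:E)%E.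
Proof.
move=> l0 lV; rewrite -/(V v) in lV *; set K := (Num.sqrt _)^-1.
have K0 : 0 <= K by rewrite invr_ge0 sqrtr_ge0.
(* Rows in [s] carry their square; the others keep a linear exponent with arbitrary coefficient, the
   form that the auxiliary Gaussian variable creates. *)
suff key (s : seq I) (c : I -> R) : uniq s ->
    (\int[P]_w (\prod_i (if i \in s then expR (l * L v i w ^+ 2)
                         else expR (c i * L v i w)))%:E =
     (\prod_i (if i \in s then K else expR (c i ^+ 2 * V v / 2)))%:E)%E.
  have := key (enum I) (fun=> 0) (enum_uniq _).
  under eq_integral => w _ do under eq_bigr => i _ do rewrite mem_enum /=.
  under [in X in _ = X -> _]eq_bigr => i _ do rewrite mem_enum /=.
  rewrite prodr_const => <-; apply: eq_integral => w _; congr EFin.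
  by rewrite -expR_sum mulr_sumr.
elim: s c => [|b s IH] c /=; first by move=> _; exact: integral_exp_linear.
move=> /andP[bs us].
pose RT := measurableTypeR R.
pose N : probability RT R := normal_prob 0 1.
pose G w := \prod_(i | i != b) (if i \in s then expR (l * L v i w ^+ 2)
                         else expR (c i * L v i w)).
pose C := \prod_(i | i != b) (if i \in s then K else expR (c i ^+ 2 * V v / 2)).
have G0 w : 0 <= G w.
  by apply: prodr_ge0 => i _; case: ifP => _; exact: expR_ge0.
have C0 : 0 <= C.
  by apply: prodr_ge0 => i _; case: ifP => _ //; exact: expR_ge0.
have mL2 i : measurable_fun setT (fun w => expR (l * L v i w ^+ 2)).
  apply: measurableT_comp => //; apply: measurable_funM => //.
  by apply: measurable_funX; exact: measurable_L.
have mL1 i : measurable_fun setT (fun w => expR (c i * L v i w)).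
  by apply: measurableT_comp => //; apply: measurable_funM.
have mG : measurable_fun setT G.
  rewrite /G; under eq_fun do rewrite big_mkcond/=.
  apply: measurable_prod => i _ /=; case: (i != b) => //.
  by case: (i \in s).
have mexp1 (a : R) : measurable_fun [set: R] (fun x : R => (expR (a * x))%:E).
  by apply/measurable_EFinP; apply: measurableT_comp => //; exact: measurable_funM.
have mexp2 (a : R) : measurable_fun [set: R] (fun x : R => (expR (a * x ^+ 2))%:E).
  by apply/measurable_EFinP; apply: measurableT_comp => //; exact: measurable_funM.
pose H (z : T * RT) := G z.1 * expR (Num.sqrt (2 * l) * L v b z.1 * z.2).
have mH : measurable_fun setT H.
  apply: measurable_funM; first exact: measurableT_comp.
  apply: measurableT_comp => //; apply: measurable_funM => //.
  apply: measurable_funM => //.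
  exact: (measurableT_comp (measurable_L v b)).
have H0 z : 0 <= H z by rewrite mulr_ge0 ?expR_ge0.
transitivity (\int[P]_w \int[N]_x (H (w, x))%:E)%E.
  apply: eq_integral => w _; rewrite /H/=.
  under eq_integral => x _ do rewrite EFinM.
  rewrite ge0_integralZl ?lee_fin//; last first.
    exact: (mexp1 (Num.sqrt (2 * l) * L v b w)).
  rewrite integral_normal_exp_linear -EFinM; congr EFin.
  rewrite (bigD1 b)//= inE eqxx/= mulrC; congr (_ * _).
    by apply: eq_bigr => i /negbTE ib; rewrite inE ib.
  congr expR; rewrite exprMn sqr_sqrtr; first by field.
  by rewrite mulr_ge0.
(* After the exchange, row [b] is linear with coefficient [Num.sqrt (2 * l) * x], so the induction
   hypothesis applies for each fixed [x]. *)
rewrite (@fubini_tonelli _ _ _ _ _ P N (fun z => (H z)%:E))//; last first.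
  by apply/measurable_EFinP.
transitivity (\int[N]_x (C * expR ((l * V v) * x ^+ 2))%:E)%E.
  apply: eq_integral => x _.
  pose c' i := if i == b then Num.sqrt (2 * l) * x else c i.
  transitivity (\int[P]_w (\prod_i (if i \in s then expR (l * L v i w ^+ 2)
                         else expR (c' i * L v i w)))%:E)%E.
    apply: eq_integral => w _; congr EFin.
    rewrite (bigD1 b)//= (negbTE bs) /c' eqxx mulrC /H /=; congr (_ * expR _).
      by apply: eq_bigr => i /negbTE ->.
    by rewrite -mulrA (mulrC (L _ _ _)) mulrA.
  rewrite IH//; congr EFin.
  rewrite (bigD1 b)//= (negbTE bs) /c' eqxx mulrC; congr (_ * expR _).
    by apply: eq_bigr => i /negbTE ->.
  rewrite exprMn sqr_sqrtr; first by field.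
  by rewrite mulr_ge0.
under eq_integral => x _ do rewrite EFinM.
rewrite ge0_integralZl ?lee_fin//; last first.
  exact: (mexp2 (l * V v)).
rewrite integral_normal_exp_square; last by nra.
rewrite mulrA -/K -EFinM; congr EFin.
rewrite [RHS](bigD1 b)//= inE eqxx/= mulrC; congr (_ * _).
by apply: eq_bigr => i /negbTE ib; rewrite inE ib.
Qed.

End Gaussian_family.

(** * Chernoff bounds for Gaussian sums of squares *)

Section Tails.
Context d (T : measurableType d) (R : realType) (P : probability T R).

(** Markov's inequality at level 1: [h] dominates the indicator of the complement. *)
Lemma probability_ge1_le_integral (h : T -> R) (r : R) :
  measurable_fun setT h -> (forall w, 0 <= h w) ->
  (\int[P]_w (h w)%:E <= r%:E)%E ->
  measurable [set w | h w < 1] /\ ((1 - r)%:E <= P [set w | (h w < 1)%R])%E.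
Proof.
move=> mh h0 hr.
have mA : measurable [set w | h w < 1].
  have := mh measurableT _ (measurable_itv `]-oo, 1[).
  by rewrite setTI; congr (measurable _); apply/seteqP; split => w /=; rewrite in_itv.
split => //.
rewrite -[X in (_ <= P X)%E]setCK probability_setC; last exact: measurableC.
rewrite EFinB leeB//.
have mC := measurableC mA.
rewrite -[X in P X]setIT -integral_indic//; apply: le_trans hr.
apply: ge0_le_integral => //.
- by apply/measurable_EFinP; exact: measurable_indic.
- by apply/measurable_EFinP.
- move=> w _; rewrite lee_fin indicE.
  case: (boolP (w \in _)) => // /[!inE]/= /negP; by rewrite -leNgt.
Qed.

Lemma inv_sqrt_le_exp (a b : R) : 0 < a -> 1 <= a * (1 + 2 * b) ->
  (Num.sqrt a)^-1 <= expR b.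
Proof.
move=> a0 ab.
have E0 := expR_gt0 b.
rewrite -[leLHS]div1r ler_pdivrMr ?sqrtr_gt0//.
rewrite -(@ler_pXn2r _ 2)// ?nnegrE//.
rewrite expr1n exprMn sqr_sqrtr ?(ltW a0)// -expRM_natl mulrC.
apply: (le_trans ab); rewrite ler_pM2l//; have := expR_ge1Dx (2 * b); lra.
Qed.

Variables (I J : finType) (Y : I -> J -> {RV P >-> R}).
Hypothesis Yindep : mutually_independent (fun a : I * J => Y a.1 a.2).
Hypothesis Ynormal : forall i j, standard_normal (Y i j).

Let measurable_S v : measurable_fun setT (fun w => \sum_i (\sum_j v j * Y i j w) ^+ 2).
Proof.
apply: measurable_sum => i; apply: measurable_funX.
by apply: measurable_sum => j; exact: measurable_funM.
Qed.

Lemma measurable_exp_sum_square (v : J -> R) (l t : R) :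
  measurable_fun setT
    (fun w => expR (l * (\sum_i (\sum_j v j * Y i j w) ^+ 2 - t))).
Proof.
apply: measurableT_comp => //; apply: measurable_funM => //.
exact: measurable_funB.
Qed.

(** Chernoff's method: [b] is an upper bound for [- ln (1 - 2 * l) / 2], the log-moment of a squared
    standard normal, certified by a polynomial inequality instead of a logarithm. *)
Lemma integral_exp_sum_square_le (v : J -> R) (l b t : R) : 0 <= l ->
  \sum_j v j ^+ 2 = 1 -> 2 * l < 1 -> 1 <= (1 - 2 * l) * (1 + 2 * b) ->
  (\int[P]_w (expR (l * (\sum_i (\sum_j v j * Y i j w) ^+ 2 - t)))%:E <=
   (expR (#|I|%:R * b - l * t))%:E)%E.
Proof.
move=> l0 v1 l1 bl.
have -> : (fun w => (expR (l * (\sum_i (\sum_j v j * Y i j w) ^+ 2 - t)))%:E) =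
   (fun w => (expR (- (l * t)))%:E *
     (expR (l * \sum_i (\sum_j v j * Y i j w) ^+ 2))%:E)%E.
  by apply/funext => w; rewrite -EFinM -expRD; congr (expR _)%:E; ring.
rewrite ge0_integralZl ?lee_fin ?expR_ge0//; last first.
  apply/measurable_EFinP/measurableT_comp => //; apply: measurable_funM => //.
rewrite integral_exp_sum_square// ?v1 ?mulr1// -EFinM lee_fin.
rewrite expRD mulrC ler_wpM2r ?expR_ge0// expRM_natl lerXn2r// ?nnegrE.
- by rewrite invr_ge0 sqrtr_ge0.
- exact: expR_ge0.
- by apply: inv_sqrt_le_exp => //; lra.
Qed.

Lemma measurable_exp_opp_sum_square (i : I) (l t : R) :
  measurable_fun setT (fun w => expR (l * (t - \sum_j Y i j w ^+ 2))).
Proof.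
apply: measurableT_comp => //; apply: measurable_funM => //.
apply: measurable_funB => //; apply: measurable_sum => j.
exact: measurable_funX.
Qed.

Lemma integral_exp_opp_sum_square_le (i : I) (l t : R) : 0 <= l ->
  (\int[P]_w (expR (l * (t - \sum_j Y i j w ^+ 2)))%:E <=
   (expR (#|J|%:R * (- l + 2 * l ^+ 2) + l * t))%:E)%E.
Proof.
move=> l0.
have -> : (fun w => (expR (l * (t - \sum_j Y i j w ^+ 2)))%:E) =
   (fun w => (expR (l * t))%:E *
     (\prod_j expR (- l * Y i j w ^+ 2))%:E)%E.
  apply/funext => w; rewrite -EFinM -expR_sum -expRD; congr (expR _)%:E.
  by rewrite -mulr_sumr; ring.
have mE : measurable_fun [set: R] (fun x : R => expR (- l * x ^+ 2)).
  by apply: measurableT_comp => //; exact: measurable_funM.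
rewrite ge0_integralZl ?lee_fin ?expR_ge0//; last 2 first.
- apply/measurable_EFinP/measurable_prod => j _.
  exact: (measurableT_comp mE).
- by move=> w _; rewrite lee_fin prodr_ge0// => j _; exact: expR_ge0.
rewrite (@ge0_integral_prod_independent _ _ _ _ J (Y i)
  (fun _ x => expR (- l * x ^+ 2)) (fun=> (Num.sqrt (1 - 2 * (- l)))^-1))//.
- rewrite prodr_const -EFinM lee_fin [_ + l * t]addrC expRD ler_wpM2l ?expR_ge0//.
  rewrite expRM_natl lerXn2r// ?nnegrE ?invr_ge0 ?sqrtr_ge0 ?expR_ge0//.
  (* With [b = - l + 2 * l ^+ 2] the condition reads [1 <= 1 + 8 * l ^+ 3]. *)
  apply: inv_sqrt_le_exp; first lra.
  have : 0 <= l ^+ 3 by apply: exprn_ge0.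
  nra.
- have inj_i : injective (fun j : J => (i, j)) by move=> j j' [].
  exact: (mutually_independent_comp inj_i Yindep).
- move=> j; rewrite (@ge0_integral_standard_normal _ _ _ _ (Y i j)
    (fun x => expR (- l * x ^+ 2)))//.
  + by apply: integral_normal_exp_square; lra.
Qed.

End Tails.

Section Good_event.
Context d (T : measurableType d) (R : realType) (P : probability T R).

(* The exponentials of all the deviations are added up, so that one application
   of Markov's inequality to the sum replaces the union bound. *)
Lemma gaussian_good_event (n p : nat) (u : 'I_n -> {RV P >-> R})
    (xi : 'I_n -> 'I_p -> {RV P >-> R}) (z : 'I_p -> R) (g : R)
    (K : finType) (v : K -> 'I_n -> R) :
  gaussian_inputs u xi -> \sum_j z j ^+ 2 = 1 ->
  (forall k, \sum_i v k i ^+ 2 = 1) ->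
  0 < g -> g <= 1 / 6 -> g ^+ 2 * p%:R = n%:R ->
  exists E : set T, [/\ measurable E,
    ((1 - (2 * expR (- (n%:R / 12)) + n%:R * expR (- (n%:R / 32)) +
           #|K|%:R * expR (- (4 * n%:R))))%:E <= P E)%E &
    forall w, E w -> [/\ \sum_i u i w ^+ 2 <= 2 * n%:R,
      \sum_i (\sum_j z j * xi i j w) ^+ 2 <= 2 * n%:R,
      forall i, p%:R * (1 - g / 2) <= \sum_j xi i j w ^+ 2 &
      forall k, \sum_j (\sum_i v k i * xi i j w) ^+ 2 <= p%:R * (1 + 7 * g)]].
Proof.
move=> [hu hxi hI] z1 v1 g0 g6 gp.
have Iu : mutually_independent (fun a : 'I_n * 'I_1 => u a.1).
  have fI : injective (fun a : 'I_n * 'I_1 => inl a.1 : 'I_n + 'I_n * 'I_p).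
    by move=> [a b] [a' b'] /= [->]; rewrite (ord1 b) (ord1 b').
  exact: (mutually_independent_comp fI hI).
have Ixi : mutually_independent (fun a : 'I_n * 'I_p => xi a.1 a.2).
  have fI : injective (fun a : 'I_n * 'I_p => inr a : 'I_n + 'I_n * 'I_p).
    by move=> a a' [].
  exact: (mutually_independent_comp fI hI).
have Ixt : mutually_independent (fun a : 'I_p * 'I_n => xi a.2 a.1).
  have fI : injective (fun a : 'I_p * 'I_n => inr (a.2, a.1) : 'I_n + 'I_n * 'I_p).
    by move=> [a b] [a' b'] [-> ->].
  exact: (mutually_independent_comp fI hI).
(* The rate [8^-1] goes with [b = 6^-1], as [(1 - 2 / 8) * (1 + 2 / 6) = 1]; the exponent is
   [n / 6 - 2 * n / 8 = - n / 12]. The [u i] enter as a family with a single column. *)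
pose h1 w := expR (8^-1 * (\sum_i (\sum_(j < 1) 1 * u i w) ^+ 2 - 2 * n%:R)).
pose h2 w := expR (8^-1 * (\sum_i (\sum_j z j * xi i j w) ^+ 2 - 2 * n%:R)).
pose h3 i w := expR (g / 8 * (p%:R * (1 - g / 2) - \sum_j xi i j w ^+ 2)).
pose h4 k w := expR (g * (\sum_j (\sum_i v k i * xi i j w) ^+ 2 - p%:R * (1 + 7 * g))).
have m1 : measurable_fun setT h1.
  exact: (measurable_exp_sum_square (fun i (_ : 'I_1) => u i) (fun=> 1)).
have m2 : measurable_fun setT h2.
  exact: (measurable_exp_sum_square (fun i j => xi i j) z).
have m3 i : measurable_fun setT (h3 i).
  exact: (measurable_exp_opp_sum_square (fun i j => xi i j) i).
have m4 k : measurable_fun setT (h4 k).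
  exact: (measurable_exp_sum_square (fun j i => xi i j) (v k)).
have i1 : (\int[P]_w (h1 w)%:E <= (expR (- (n%:R / 12)))%:E)%E.
  apply: le_trans (integral_exp_sum_square_le (b := 6^-1) Iu (fun i _ => hu i) _ _ _ _ _) _ => //;
    [by rewrite big_ord1 expr1n|lra|lra|].
  by rewrite lee_fin ler_expR card_ord; lra.
have i2 : (\int[P]_w (h2 w)%:E <= (expR (- (n%:R / 12)))%:E)%E.
  apply: le_trans (integral_exp_sum_square_le (b := 6^-1) Ixi hxi _ _ _ _ _) _ => //;
    [lra|lra|].
  by rewrite lee_fin ler_expR card_ord; lra.
(* The exponent is [p * g ^+ 2 * (1 / 32 - 1 / 16)], and [p * g ^+ 2 = n]. *)
have i3 i : (\int[P]_w (h3 i w)%:E <= (expR (- (n%:R / 32)))%:E)%E.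
  apply: le_trans (integral_exp_opp_sum_square_le Ixi hxi i _ _) _ => //; [lra|].
  rewrite lee_fin ler_expR card_ord -gp; lra.
(* The condition on [b] amounts to [0 <= 2 * g ^+ 2 * (1 - 6 * g)], whence [g <= 1 / 6]. The
   exponent is [p * (3 - 7) * g ^+ 2 = - 4 * n]. *)
have i4 k : (\int[P]_w (h4 k w)%:E <= (expR (- (4 * n%:R)))%:E)%E.
  apply: le_trans (integral_exp_sum_square_le (b := g + 3 * g ^+ 2) Ixt
    (fun j i => hxi i j) _ _ _ _ _) _ => //;
    [lra|lra|nra|].
  by rewrite lee_fin ler_expR card_ord -gp; lra.
pose H w := h1 w + h2 w + \sum_i h3 i w + \sum_k h4 k w.
have h10 w : 0 <= h1 w by exact: expR_ge0.
have h20 w : 0 <= h2 w by exact: expR_ge0.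
have h30 i w : 0 <= h3 i w by exact: expR_ge0.
have h40 k w : 0 <= h4 k w by exact: expR_ge0.
have s30 w : 0 <= \sum_i h3 i w by exact: sumr_ge0.
have s40 w : 0 <= \sum_k h4 k w by exact: sumr_ge0.
have ms3 : measurable_fun setT (fun w => \sum_i h3 i w) by exact: measurable_sum.
have ms4 : measurable_fun setT (fun w => \sum_k h4 k w) by exact: measurable_sum.
have H0 w : 0 <= H w by rewrite !addr_ge0.
have mH : measurable_fun setT H by do 3! apply: measurable_funD => //.
pose r := 2 * expR (- (n%:R / 12)) + n%:R * expR (- (n%:R / 32)) +
  #|K|%:R * expR (- (4 * n%:R)) : R.
have intH : (\int[P]_w (H w)%:E <= r%:E)%E.
  have -> : (fun w => (H w)%:E) = (fun w => (h1 w)%:E + (h2 w)%:E +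
      \sum_i (h3 i w)%:E + \sum_k (h4 k w)%:E)%E.
    by apply/funext => w; rewrite !sumEFin -!EFinD.
  have E1 : measurable_fun setT (fun w => (h1 w)%:E) by apply/measurable_EFinP.
  have E2 : measurable_fun setT (fun w => (h2 w)%:E) by apply/measurable_EFinP.
  have E3 i : measurable_fun setT (fun w => (h3 i w)%:E) by apply/measurable_EFinP.
  have E4 k : measurable_fun setT (fun w => (h4 k w)%:E) by apply/measurable_EFinP.
  have F3 : measurable_fun setT (fun w => \sum_i (h3 i w)%:E)%E.
    exact: emeasurable_sum.
  have F4 : measurable_fun setT (fun w => \sum_i (h4 i w)%:E)%E.
    exact: emeasurable_sum.
  have G3 w : (0 <= \sum_i (h3 i w)%:E)%E by rewrite sumEFin lee_fin.
  have G4 w : (0 <= \sum_k (h4 k w)%:E)%E by rewrite sumEFin lee_fin.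
  rewrite ge0_integralD//; last 2 first.
  - by move=> w _; rewrite !adde_ge0 ?lee_fin.
  - by do 2! apply: emeasurable_funD => //.
  rewrite ge0_integralD//; last 2 first.
  - by move=> w _; rewrite !adde_ge0 ?lee_fin.
  - exact: emeasurable_funD.
  rewrite ge0_integralD//; last 2 first.
  - by move=> w _; rewrite lee_fin.
  - by move=> w _; rewrite lee_fin.
  rewrite ge0_integral_sum//; last by move=> i w _; rewrite lee_fin.
  rewrite ge0_integral_sum//; last by move=> i w _; rewrite lee_fin.
  rewrite /r !EFinD; apply: leeD; first apply: leeD.
  - by rewrite mulr_natl mulr2n EFinD; apply: leeD.
  - apply: (@le_trans _ _ (\sum_(i < n) (expR (- (n%:R / 32)))%:E)%E).
      by apply: lee_sum => i _.
    by rewrite sumEFin sumr_const card_ord -[expR _ *+ _]mulr_natl.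
  - apply: (@le_trans _ _ (\sum_(i : K) (expR (- (4 * n%:R)))%:E)%E).
      by apply: lee_sum => i _.
    by rewrite sumEFin sumr_const -[expR _ *+ _]mulr_natl.
have [mE PE] := probability_ge1_le_integral mH H0 intH.
exists [set w | H w < 1]; split => // w /= Hw.
(* The summands of [H] are nonnegative, so [H w < 1] puts each exponential below 1 and makes each
   deviation nonpositive. *)
have pos (c x : R) : 0 < c -> expR (c * x) < 1 -> x <= 0.
  move=> c0; rewrite -[X in _ < X]expR0 ltr_expR => cx.
  by rewrite leNgt; apply/negP => x0; have := mulr_gt0 c0 x0; lra.
have H1 : h1 w < 1 by move: Hw (h20 w) (s30 w) (s40 w); rewrite /H; lra.
have H2 : h2 w < 1 by move: Hw (h10 w) (s30 w) (s40 w); rewrite /H; lra.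
have H3 i : h3 i w < 1.
  apply: le_lt_trans (_ : \sum_i h3 i w < 1).
    by rewrite (bigD1 i)//= lerDl sumr_ge0.
  by move: Hw (h10 w) (h20 w) (s40 w); rewrite /H; lra.
have H4 k : h4 k w < 1.
  apply: le_lt_trans (_ : \sum_k h4 k w < 1).
    by rewrite (bigD1 k)//= lerDl sumr_ge0.
  by move: Hw (h10 w) (h20 w) (s30 w); rewrite /H; lra.
split.
- have := pos _ _ _ H1; rewrite subr_le0 => /(_ ltac:(lra)).
  apply: le_trans; apply: ler_sum => i _; by rewrite big_ord1 mul1r.
- by have := pos _ _ _ H2; rewrite subr_le0 => /(_ ltac:(lra)).
- by move=> i; have := pos _ _ _ (H3 i); rewrite subr_le0 => /(_ ltac:(lra)).
- by move=> k; have := pos _ _ _ (H4 k); rewrite subr_le0 => /(_ ltac:(lra)).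
Qed.

End Good_event.

(** * Operator norm of the noise *)

Section Rounding.
Context {R : realType} {n : nat}.

Definition update (x : 'I_n -> R) i (a : R) : 'I_n -> R :=
  fun j => if j == i then a else x j.

Lemma update_eq (x : 'I_n -> R) i a : update x i a i = a.
Proof. by rewrite /update eqxx. Qed.

Lemma update_neq (x : 'I_n -> R) i a j : j != i -> update x i a j = x j.
Proof. by rewrite /update => /negbTE ->. Qed.

Lemma update_id (x : 'I_n -> R) i : update x i (x i) = x.
Proof. by apply/funext => j; rewrite /update; case: eqP => [->|]. Qed.

(* Rounding a coordinate up or down at random, without bias, raises the
   expectation of [N a^2 + b a + c] by [N f (1 - f)], [f] the fractional part;
   so one of the two roundings does at least as well. *)
Lemma integer_rounding (F : ('I_n -> R) -> R) (N : 'I_n -> R) (D : R) :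
  (forall x i, exists b c, forall a, F (update x i a) = N i * a ^+ 2 + b * a + c) ->
  0 <= D -> (forall i, - D <= N i) ->
  forall w, exists m : 'I_n -> int,
    (forall i, `|(m i)%:~R - w i| <= 1) /\
    F w <= F (fun i => (m i)%:~R) + n%:R * (D / 4).
Proof.
move=> Fq D0 ND w.
suff key (s : seq 'I_n) : uniq s -> exists x : 'I_n -> R,
    [/\ forall i, i \notin s -> x i = w i,
        forall i, i \in s -> exists2 k : int, x i = k%:~R & `|k%:~R - w i| <= 1 &
        F w <= F x + (size s)%:R * (D / 4)].
  have [x [_ xs Fx]] := key (enum 'I_n) (enum_uniq _).
  have /choice[m mP] i : exists k : int, x i = k%:~R /\ `|k%:~R - w i| <= 1.
    by have [|k ? ?] := xs i; [rewrite mem_enum|exists k].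
  exists m; split => [i|]; first exact: (mP i).2.
  have -> : (fun i => (m i)%:~R) = x by apply/funext => i; rewrite (mP i).1.
  by rewrite size_enum_ord in Fx.
elim: s => [|i s IH] /=; first by exists w; split => //; rewrite mul0r addr0.
move=> /andP[is_ us]; have [x [xw xs Fx]] := IH us.
have [b [c Fi]] := Fq x i.
have xi : x i = w i by exact: xw.
pose k := Num.floor (w i); pose f := w i - k%:~R.
have f0 : 0 <= f by rewrite subr_ge0 floor_le_tmp.
have f1 : f < 1.
  by have := floorD1_gt (w i); rewrite /f -/k intrD; lra.
have FxE : F x = N i * w i ^+ 2 + b * w i + c by rewrite -Fi -xi update_id.
have [a [aP Fa]] : exists a : int, `|a%:~R - w i| <= 1 /\
    F x <= F (update x i a%:~R) + D / 4.
  have wE : w i = k%:~R + f by rewrite /f; ring.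
  have Ff : - (D / 4) <= N i * (f * (1 - f)).
    have : f * (1 - f) <= 1 / 4 by have := sqr_ge0 (f - 1 / 2); lra.
    have : 0 <= f * (1 - f) by nra.
    by have := ND i; nra.
  have avg : F x + N i * (f * (1 - f)) =
      (1 - f) * F (update x i k%:~R) + f * F (update x i (k + 1)%:~R).
    by rewrite FxE !Fi wE intrD; ring.
  have [h|h] := lerP (F x) (F (update x i k%:~R) + D / 4).
    by exists k; split => //; rewrite distrC -/f ger0_norm // ltW.
  exists (k + 1); split.
    rewrite intrD ler_norml; apply/andP; split; rewrite wE; lra.
  (* If both roundings lost more than [D / 4], so would their average in [avg]. *)
  rewrite leNgt; apply/negP => h'; nra.
exists (update x i a%:~R); split.
- move=> j; rewrite inE negb_or => /andP[/negbTE ji js].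
  by rewrite /update ji; exact: xw.
- move=> j; rewrite inE /update; case: eqP => [->|_ /= js]; first by exists a.
  exact: xs.
- by rewrite -[(size s).+1]addn1 natrD; lra.
Qed.

End Rounding.

(** * Counting the integer points of a ball *)

Section Integer_net.
Context {R : realType}.
Variable n : nat.
Local Notation B := (2 * n)%N.

(* The index [j] encodes the integer [j - 2n]. *)
Definition net_coord (m : {ffun 'I_n -> 'I_(B + B.+1)}) (i : 'I_n) : int :=
  (m i : nat)%:Z - B%:Z.

Definition net_norm m : R := \sum_i (net_coord m i)%:~R ^+ 2.

Definition integer_net : {set {ffun 'I_n -> 'I_(B + B.+1)}} :=
  [set m | 0 < net_norm m <= 4 * n%:R].

Let sum_geom k : \sum_(i < k) (2^-1 : R) ^+ i.+1 = 1 - 2^-1 ^+ k.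
Proof.
elim: k => [|k IH]; first by rewrite big_ord0 expr0 subrr.
rewrite big_ord_recr /= IH exprS; lra.
Qed.

(** A two-sided geometric series: negative offsets contribute [1 - 2^-1 ^+ B], the others
    [2 - 2^-1 ^+ B]. *)
Let sum_weights :
  \sum_(j < B + B.+1) (2^-1 : R) ^+ `|(j : nat)%:Z - B%:Z|%N <= 3.
Proof.
rewrite big_split_ord /=.
have -> : \sum_(i < B) (2^-1 : R) ^+ `|(i : nat)%:Z - B%:Z|%N =
    \sum_(i < B) (2^-1 : R) ^+ i.+1.
  rewrite (reindex_inj rev_ord_inj)/=; apply: eq_bigr => i _; congr (_ ^+ _).
  have := ltn_ord i; lia.
have -> : \sum_(i < B.+1) (2^-1 : R) ^+ `|(B + i)%:Z - B%:Z|%N =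
    \sum_(i < B.+1) (2^-1 : R) ^+ i.
  by apply: eq_bigr => i _; congr (_ ^+ _); lia.
rewrite big_ord_recl expr0 !sum_geom.
have : 0 <= (2^-1 : R) ^+ B by apply: exprn_ge0.
lra.
Qed.

(* Each point [m] of the net is counted with weight [2 ^ (4n - |m|^2) >= 1], and
   the sum of these weights over all [m] factorises. *)
Lemma card_integer_net : #|integer_net|%:R <= 48 ^+ n :> R.
Proof.
(* The factor [16 = 2 ^+ 4] spreads [2 ^+ (4 * n)] over the coordinates. Using the absolute value of
   an integer in place of its square in the exponent only increases the weight. Each coordinate sums
   to at most [16 * 3 = 48]. *)
pose wt (j : 'I_(B + B.+1)) : R := 16 * 2^-1 ^+ `|(j : nat)%:Z - B%:Z|%N.
have wt0 j : 0 <= wt j by rewrite mulr_ge0// exprn_ge0.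
have h : \sum_(m : {ffun 'I_n -> 'I_(B + B.+1)}) \prod_i wt (m i) <= 48 ^+ n.
  rewrite -(bigA_distr_bigA (fun (_ : 'I_n) j => wt j)) prodr_const card_ord.
  rewrite lerXn2r// ?nnegrE//; first exact: sumr_ge0.
  by rewrite -mulr_sumr; have := sum_weights; lra.
apply: le_trans h; rewrite -sum1_card natr_sum.
rewrite big_mkcond /=; apply: ler_sum => m _; case: ifP => [|_]; last first.
  exact: prodr_ge0.
rewrite inE => /andP[_ mn].
have le_wt i : (2 : R) ^+ 4 * 2^-1 ^+ `|net_coord m i ^+ 2|%N <= wt (m i).
  rewrite /wt (_ : 2 ^+ 4 = 16 :> R); last by ring.
  rewrite ler_pM2l//; apply: ler_wiXn2l; [lra|lra|].
  rewrite /net_coord abszX; set a := `|_|%N; nia.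
apply: le_trans (_ : \prod_i ((2 : R) ^+ 4 * 2^-1 ^+ `|net_coord m i ^+ 2|%N) <= _).
  rewrite big_split /= prodr_const card_ord -exprM prodrXr.
  set e := (\sum_i _)%N.
  have e4 : (e <= 4 * n)%N.
    rewrite -(ler_nat R) natr_sum natrM; apply: le_trans mn.
    apply: ler_sum => i _.
    by rewrite natr_absz ger0_norm ?sqr_ge0// rmorphXn.
  rewrite -(subnK e4) exprD -mulrA -exprMn divff// expr1n mulr1.
  by apply: exprn_ege1; lra.
by apply: ler_prod => i _; rewrite le_wt andbT mulr_ge0// exprn_ge0.
Qed.

End Integer_net.

Section Operator_norm.
Context {R : realType}.

(** Each coordinate has square at most [4 * n <= (2 * n) ^ 2], [n] being positive once a coordinate
    exists, so it lies in the encoded range. *)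
Lemma integer_net_surj n (m : 'I_n -> int) :
  \sum_i (m i)%:~R ^+ 2 <= 4 * n%:R :> R ->
  exists m' : {ffun 'I_n -> 'I_(2 * n + (2 * n).+1)}, net_coord m' = m.
Proof.
move=> mn.
have mi i : (`|m i| <= 2 * n)%N.
  have : (m i)%:~R ^+ 2 <= 4 * n%:R :> R.
    apply: le_trans mn; rewrite [leRHS](bigD1 i)//= lerDl.
    by apply: sumr_ge0 => j _; exact: sqr_ge0.
  have -> : (m i)%:~R ^+ 2 = (`|m i| ^ 2)%N%:R :> R.
    by rewrite natrX natr_absz intr_norm real_normK// num_real.
  rewrite -natrM ler_nat; have := ltn_ord i; nia.
have /choice[f fP] i : exists j : 'I_(2 * n + (2 * n).+1),
    (j : nat)%:Z - (2 * n)%:Z = m i.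
  have lt_i : (`|(m i + (2 * n)%:Z)%R| < 2 * n + (2 * n).+1)%N by have := mi i; lia.
  by exists (Ordinal lt_i) => /=; have := mi i; lia.
by exists (finfun f); apply/funext => i; rewrite /net_coord ffunE.
Qed.

(** [F] is the excess over the bound valid on the net. It is quadratic in each coordinate, so
    rounding applies; the loss [n * D / 4 = 15 / 8 * p * g * n] turns the 7 into a 9. *)
Lemma op_norm_of_net n p (xi : 'I_n -> 'I_p -> R) (g : R) :
  0 < g ->
  (forall i, p%:R * (1 - g / 2) <= \sum_j xi i j ^+ 2) ->
  (forall m, m \in @integer_net R n ->
    \sum_j (\sum_i (net_coord m i)%:~R * xi i j) ^+ 2 <=
    p%:R * (1 + 7 * g) * net_norm m) ->
  forall v : 'I_n -> R, \sum_j (\sum_i v i * xi i j) ^+ 2 <=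
    p%:R * (1 + 9 * g) * \sum_i v i ^+ 2.
Proof.
move=> g0 hcol hnet v.
have p0 : 0 <= p%:R :> R by [].
pose k := p%:R * (1 + 7 * g).
pose F (x : 'I_n -> R) := \sum_j (\sum_i x i * xi i j) ^+ 2 - k * \sum_i x i ^+ 2.
have Fq x i : exists b c, forall a, F (update x i a) =
    (\sum_j xi i j ^+ 2 - k) * a ^+ 2 + b * a + c.
  pose r j := \sum_(l | l != i) x l * xi l j.
  exists (2 * \sum_j xi i j * r j).
  exists (\sum_j r j ^+ 2 - k * \sum_(l | l != i) x l ^+ 2) => a.
  rewrite /F [X in k * X](bigD1 i)//= update_eq.
  rewrite (eq_bigr (fun l => x l ^+ 2)); last by move=> l /update_neq ->.
  have -> : \sum_j (\sum_i0 update x i a i0 * xi i0 j) ^+ 2 =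
      \sum_j (xi i j ^+ 2 * a ^+ 2 + 2 * a * (xi i j * r j) + r j ^+ 2).
    apply: eq_bigr => j _; rewrite (bigD1 i)//= update_eq.
    rewrite (eq_bigr (fun l => x l * xi l j)); last first.
      by move=> l /update_neq ->.
    by rewrite -/(r j); ring.
  rewrite !big_split/= -mulr_suml -mulr_sumr; ring.
have sq0 (w : 'I_n -> R) i : true -> 0 <= w i ^+ 2 by rewrite sqr_ge0.
have ssq0 (w : 'I_n -> R) : 0 <= \sum_i w i ^+ 2 by apply: sumr_ge0 => i; exact: sq0.
have [v0|vn0] := eqVneq (\sum_i v i ^+ 2) 0.
  have vi i : v i = 0.
    by apply/eqP; rewrite -sqrf_eq0; apply/eqP; exact: (psumr_eq0P (sq0 v) v0).
  rewrite v0 mulr0 big1// => j _; rewrite big1 ?expr0n//= => i _.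
  by rewrite vi mul0r.
have vgt0 : 0 < \sum_i v i ^+ 2 by rewrite lt_neqAle eq_sym vn0 ssq0.
have n0 : 0 < n%:R :> R.
  rewrite ltr0n lt0n; apply/eqP => n0; move: vgt0.
  by rewrite big1 ?ltxx// => i _; have := ltn_ord i; rewrite [in X in (_ < X)%N]n0.
(* By homogeneity [v] may be rescaled to squared norm [n], where moving each coordinate by at most 1
   keeps the squared norm below [4 * n]. *)
pose s := Num.sqrt (n%:R / \sum_i v i ^+ 2).
have s2 : s ^+ 2 * \sum_i v i ^+ 2 = n%:R.
  by rewrite sqr_sqrtr ?divfK// divr_ge0// ltW.
pose w i := s * v i.
have w2 : \sum_i w i ^+ 2 = n%:R.
  by rewrite -s2 mulr_sumr; apply: eq_bigr => i _; rewrite exprMn.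
(* The leading coefficients are at least [p * (1 - g / 2) - p * (1 + 7 * g) = - D]. *)
pose D := p%:R * (15 / 2 * g).
have D0 : 0 <= D by rewrite mulr_ge0// mulr_ge0// ltW.
have ND i : - D <= \sum_j xi i j ^+ 2 - k.
  by have := hcol i; rewrite /D /k; lra.
have [m [mw Fm]] := integer_rounding Fq D0 ND w.
have m4 : \sum_i (m i)%:~R ^+ 2 <= 4 * n%:R :> R.
  rewrite (_ : 4 * n%:R = \sum_(i < n) (2 * w i ^+ 2 + 2)); last first.
    by rewrite big_split/= -mulr_sumr w2 sumr_const card_ord -[2 *+ n]mulr_natl; ring.
  apply: ler_sum => i _; have := mw i; rewrite ler_norml => /andP[h1 h2].
  have h3 : ((m i)%:~R - w i) ^+ 2 <= 1 by nra.
  by have := sqr_ge0 ((m i)%:~R - 2 * w i); nra.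
have F0 : F (fun i => (m i)%:~R) <= 0.
  have [m' m'E] := integer_net_surj m4.
  have mm : net_norm m' = \sum_i (m i)%:~R ^+ 2 :> R.
    by apply: eq_bigr => i _; rewrite m'E.
  rewrite /F subr_le0.
  (* The zero vector is not in the net, but [F] vanishes there. *)
  have [m0|mn0] := eqVneq (\sum_i (m i)%:~R ^+ 2 : R) 0.
    have mi i : (m i)%:~R = 0 :> R.
      apply/eqP; rewrite -sqrf_eq0; apply/eqP.
      exact: (psumr_eq0P (sq0 (fun i => (m i)%:~R)) m0).
    rewrite m0 mulr0 big1// => j _; rewrite big1 ?expr0n//= => i _.
    by rewrite mi mul0r.
  rewrite -mm; have := hnet m'.
  rewrite inE mm m4 andbT lt_neqAle eq_sym mn0 ssq0 => /(_ isT).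
  by rewrite m'E.
have Fw : \sum_j (\sum_i w i * xi i j) ^+ 2 <= k * n%:R + n%:R * (D / 4).
  by move: Fm F0; rewrite {1}/F w2; lra.
have sv : \sum_j (\sum_i w i * xi i j) ^+ 2 =
    s ^+ 2 * \sum_j (\sum_i v i * xi i j) ^+ 2.
  rewrite mulr_sumr; apply: eq_bigr => j _; rewrite -exprMn mulr_sumr.
  by congr (_ ^+ 2); apply: eq_bigr => i _; rewrite mulrA.
have sgt0 : 0 < s ^+ 2 by rewrite exprn_gt0// sqrtr_gt0 divr_gt0.
rewrite -(ler_pM2l sgt0) -sv (mulrCA (s ^+ 2)) s2.
apply: le_trans Fw _; rewrite /k /D.
have : 0 <= p%:R * g * n%:R by rewrite !mulr_ge0// ltW.
nra.
Qed.

End Operator_norm.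

(** * The semidefinite program *)

Section Matrices.
Context {R : realType}.

Lemma mxdotE m n (A B : 'M[R]_(m, n)) : mxdot A B = \tr (A^T *m B).
Proof.
rewrite /mxdot exchange_big; apply: eq_bigr => j _.
by rewrite mxE; apply: eq_bigr => i _; rewrite mxE.
Qed.

Lemma mxdotC m n (A B : 'M[R]_(m, n)) : mxdot A B = mxdot B A.
Proof. by apply: eq_bigr => i _; apply: eq_bigr => j _; rewrite mulrC. Qed.

Lemma mxdotZl m n a (A B : 'M[R]_(m, n)) : mxdot (a *: A) B = a * mxdot A B.
Proof. by rewrite !mxdotE linearZ/= -scalemxAl linearZ. Qed.

Lemma mxdotDl m n (A B C : 'M[R]_(m, n)) :
  mxdot (A + B) C = mxdot A C + mxdot B C.
Proof. by rewrite !mxdotE linearD/= mulmxDl linearD. Qed.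

Lemma mxdotZr m n a (A B : 'M[R]_(m, n)) : mxdot A (a *: B) = a * mxdot A B.
Proof. by rewrite mxdotC mxdotZl mxdotC. Qed.

Lemma mxdotDr m n (A B C : 'M[R]_(m, n)) :
  mxdot C (A + B) = mxdot C A + mxdot C B.
Proof. by rewrite mxdotC mxdotDl !(mxdotC C). Qed.

Lemma mxdot_suml m n (I : Type) (s : seq I) (F : I -> 'M[R]_(m, n)) B :
  mxdot (\sum_(i <- s) F i) B = \sum_(i <- s) mxdot (F i) B.
Proof.
by rewrite mxdotE linear_sum/= mulmx_suml linear_sum/=; apply: eq_bigr => i _; rewrite mxdotE.
Qed.

Lemma mxdot_sumr m n (I : Type) (s : seq I) (F : I -> 'M[R]_(m, n)) B :
  mxdot B (\sum_(i <- s) F i) = \sum_(i <- s) mxdot B (F i).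
Proof. by rewrite mxdotC mxdot_suml; apply: eq_bigr => i _; rewrite mxdotC. Qed.

Lemma mxdot_col p (x y : 'cV[R]_p) : mxdot x y = \sum_i x i 0 * y i 0.
Proof. by apply: eq_bigr => i _; rewrite big_ord1. Qed.

Lemma mxdot_mulmx p (x y : 'cV[R]_p) : (x^T *m y) 0 0 = mxdot x y.
Proof. by rewrite mxdot_col mxE; apply: eq_bigr => i _; rewrite mxE. Qed.

Lemma mxdot_sq_ge0 m n (A : 'M[R]_(m, n)) : 0 <= mxdot A A.
Proof.
by apply: sumr_ge0 => i _; apply: sumr_ge0 => j _; rewrite -expr2 sqr_ge0.
Qed.

Lemma mx11_mxdot p (x y : 'cV[R]_p) : x^T *m y = (mxdot x y)%:M.
Proof. by rewrite [LHS]mx11_scalar mxdot_mulmx. Qed.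

Lemma mxdot_outer p (x y : 'cV[R]_p) :
  mxdot (x *m x^T) (y *m y^T) = mxdot x y ^+ 2.
Proof.
rewrite mxdotE trmx_mul trmxK mulmxA mxtrace_mulC !mulmxA -mulmxA.
rewrite !mx11_mxdot -scalar_mxM mxtrace_scalar mulr1n (mxdotC y).
by rewrite expr2.
Qed.

Lemma quad_outer p (v y : 'cV[R]_p) :
  (v^T *m (y *m y^T) *m v) 0 0 = mxdot v y ^+ 2.
Proof.
rewrite mulmxA -mulmxA !mx11_mxdot -scalar_mxM mxE eqxx mulr1n (mxdotC y).
by rewrite expr2.
Qed.

Lemma discriminant_le (a b c : R) : 0 <= c ->
  (forall t, 0 <= a + 2 * t * b + t ^+ 2 * c) -> b ^+ 2 <= a * c.
Proof.
move=> c0 H; have [c00|cn0] := eqVneq c 0.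
  have [->|b0] := eqVneq b 0; first by rewrite c00 mulr0 expr0n.
  (* For [c = 0] the polynomial is affine in [t] and equals -1 at this point. *)
  have := H (- (a + 1) / (2 * b)); rewrite c00 mulr0 addr0.
  rewrite (_ : a + _ = -1); first by rewrite lerNr oppr0 ler10.
  by field.
have c1 : 0 < c by rewrite lt_neqAle eq_sym cn0.
have := H (- b / c); rewrite (_ : a + _ + _ = (a * c - b ^+ 2) / c); last by field.
by rewrite pmulr_lge0 ?invr_gt0// subr_ge0.
Qed.

Lemma mxdot_cauchy p (x y : 'cV[R]_p) :
  mxdot x y ^+ 2 <= mxdot x x * mxdot y y.
Proof.
apply: discriminant_le; first exact: mxdot_sq_ge0.
move=> t; have := mxdot_sq_ge0 (x + t *: y).
by rewrite !mxdotDl !mxdotDr !mxdotZl !mxdotZr (mxdotC y x); congr (0 <= _); ring.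
Qed.

Definition mxform p (X : 'M[R]_p) (u v : 'cV[R]_p) : R := (u^T *m X *m v) 0 0.

Lemma mxform_mxdot p (X : 'M[R]_p) u v : mxform X u v = mxdot u (X *m v).
Proof. by rewrite /mxform -mulmxA mxdot_mulmx. Qed.

Lemma mxform_cauchy p (X : 'M[R]_p) u v : possemidef X ->
  mxform X u v ^+ 2 <= mxform X u u * mxform X v v.
Proof.
move=> [Xs X0]; apply: discriminant_le; first exact: X0.
move=> t; have := X0 (u + t *: v); rewrite -/(mxform _ _ _) !mxform_mxdot.
rewrite mulmxDr -scalemxAr !mxdotDl !mxdotDr !mxdotZl !mxdotZr.
have -> : mxdot v (X *m u) = mxdot u (X *m v).
  by rewrite !mxdotE -mxtrace_tr trmx_mul trmxK trmx_mul Xs mulmxA.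
by congr (0 <= _); ring.
Qed.

Lemma mxform_delta p (X : 'M[R]_p) v i :
  X^T = X -> mxform X v (delta_mx i 0) = mxdot v (col i X).
Proof. by move=> Xs; rewrite mxform_mxdot -colE. Qed.

Lemma mxform_delta2 p (X : 'M[R]_p) i j :
  mxform X (delta_mx i 0) (delta_mx j 0) = X i j.
Proof.
by rewrite /mxform trmx_delta -rowE -colE !mxE.
Qed.

(** Cholesky elimination: subtracting the rank-one matrix built on the column of a nonzero pivot
    leaves a positive semidefinite matrix, by Cauchy-Schwarz for the form. The pivot entry vanishes
    and zero diagonal entries stay zero, so the number of nonzero ones drops; a zero diagonal forces
    the zero matrix. *)
Lemma possemidef_sum_outer p (X : 'M[R]_p) : possemidef X ->
  exists s : seq 'cV[R]_p, X = \sum_(y <- s) y *m y^T.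
Proof.
have [k] := ubnP #|[set i | X i i != 0]|%SET.
elim: k X => // k IH X kX psdX.
have [Xs X0] := psdX.
have sq_le i j : X i j ^+ 2 <= X i i * X j j.
  by rewrite -!mxform_delta2; exact: mxform_cauchy.
have [[i Xi]|h0] := pselect (exists i, X i i != 0); last first.
  exists [::]; rewrite big_nil.
  apply/matrixP => i j; rewrite mxE; apply/eqP; rewrite -sqrf_eq0 eq_le sqr_ge0 andbT.
  have Xi : X i i = 0 by apply/eqP; apply: contrapT => /negP Xi; apply: h0; exists i.
  by apply: le_trans (sq_le i j) _; rewrite Xi mul0r.
have Xi0 : 0 < X i i.
  by rewrite lt_neqAle eq_sym Xi/= -mxform_delta2; exact: X0.
pose y := (Num.sqrt (X i i))^-1 *: col i X.
have yyE : y *m y^T = (X i i)^-1 *: (col i X *m (col i X)^T).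
  rewrite /y linearZ/= -scalemxAl -scalemxAr scalerA -invfM -expr2 sqr_sqrtr//.
  exact: ltW.
have yy j l : (y *m y^T) j l = (X i i)^-1 * (X j i * X l i).
  by rewrite yyE !mxE big_ord1 !mxE.
have psd' : possemidef (X - y *m y^T).
  split; first by rewrite linearB/= Xs trmx_mul trmxK.
  move=> v; rewrite mulmxBr mulmxBl mxE [X in _ + X]mxE quad_outer subr_ge0.
  rewrite -/(mxform X v v) /y mxdotZr exprMn exprVn sqr_sqrtr ?(ltW Xi0)//.
  rewrite ler_pdivrMl// -mxform_delta// -(mxform_delta2 X i i) mulrC.
  exact: mxform_cauchy.
have [s sE] : exists s : seq 'cV[R]_p, X - y *m y^T = \sum_(y <- s) y *m y^T.
  apply: IH => //; rewrite -ltnS; apply: leq_trans kX; rewrite ltnS.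
  apply: proper_card; apply/properP; split.
    apply/fintype.subsetP => j; rewrite !inE; apply: contra => /eqP Xj.
    rewrite mxE [in X in _ + X]mxE yy Xj sub0r oppr_eq0 !mulf_eq0.
    have : X j i ^+ 2 <= 0 by apply: le_trans (sq_le j i) _; rewrite Xj mul0r.
    rewrite -[_ <= 0]andbT -(sqr_ge0 (X j i)) -eq_le sqrf_eq0 => ->.
    by rewrite !orbT.
  exists i; rewrite !inE // mxE [in X in _ + X]mxE yy negbK mulKf ?subrr//.
by exists (y :: s); rewrite big_cons -sE addrC subrK.
Qed.

End Matrices.

(** * Bounds on the objective value *)

Section Sdp_bound.
Context {R : realType}.

Lemma sum_sq_ge0 (I : finType) (f : I -> R) : 0 <= \sum_i f i ^+ 2.
Proof. by apply: sumr_ge0 => i _; exact: sqr_ge0. Qed.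

Lemma sqr_sum_le (I : finType) (f : I -> R) :
  (\sum_i f i) ^+ 2 <= #|I|%:R * \sum_i f i ^+ 2.
Proof.
rewrite mulrC; apply: discriminant_le => // t.
rewrite (_ : _ + _ = \sum_i (f i + t) ^+ 2); first exact: sum_sq_ge0.
under [RHS]eq_bigr => i _ do rewrite sqrrD.
rewrite !big_split/= sumr_const -!mulr_suml -[t ^+ 2 *+ _]mulr_natr; ring.
Qed.

Lemma mxnormS_sq_le p (A : 'M[R]_p) : mxnormS A ^+ 2 <= p%:R ^+ 2 * mxdot A A.
Proof.
have h := sqr_sum_le (fun a : 'I_p * 'I_p => `|A a.1 a.2|).
rewrite card_prod card_ord natrM -expr2 in h.
rewrite /mxnormS /mxdot !pair_bigA/=; apply: le_trans h _.
rewrite ler_wpM2l ?sqr_ge0//; apply: ler_sum => a _.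
by rewrite real_normK ?num_real// expr2.
Qed.

Lemma mxtrace_outer p (y : 'cV[R]_p) : \tr (y *m y^T) = mxdot y y.
Proof. by rewrite mxtrace_mulC mx11_mxdot mxtrace_scalar mulr1n. Qed.

Lemma mxform_sum_outer p (I : Type) (s : seq I) (y : I -> 'cV[R]_p) v :
  mxform (\sum_(i <- s) y i *m (y i)^T) v v = \sum_(i <- s) mxdot v (y i) ^+ 2.
Proof.
rewrite /mxform mulmx_sumr mulmx_suml summxE; apply: eq_bigr => i _.
by rewrite quad_outer.
Qed.

Lemma possemidef_sum p (I : Type) (s : seq I) (y : I -> 'cV[R]_p) :
  possemidef (\sum_(i <- s) y i *m (y i)^T).
Proof.
split.
  by rewrite linear_sum/=; apply: eq_bigr => i _; rewrite trmx_mul trmxK.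
move=> v; rewrite -/(mxform _ _ _) mxform_sum_outer.
by apply: sumr_ge0 => i _; exact: sqr_ge0.
Qed.

Lemma possemidefZ p a (A : 'M[R]_p) : 0 <= a -> possemidef A -> possemidef (a *: A).
Proof.
move=> a0 [As A0]; split; first by rewrite linearZ/= As.
by move=> v; rewrite -scalemxAr -scalemxAl mxE mulr_ge0.
Qed.

(** A map and its adjoint have the same norm: with [v i = mxdot (xi i) y], Cauchy-Schwarz gives
    [V ^+ 2 <= L * V * mxdot y y]. *)
Lemma op_norm_dual p (I : finType) (xi : I -> 'cV[R]_p) (L : R) : 0 <= L ->
  (forall v : I -> R, mxdot (\sum_i v i *: xi i) (\sum_i v i *: xi i) <=
                      L * \sum_i v i ^+ 2) ->
  forall y, \sum_i mxdot (xi i) y ^+ 2 <= L * mxdot y y.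
Proof.
move=> L0 H y; pose v i := mxdot (xi i) y; pose V := \sum_i v i ^+ 2.
have VE : V = mxdot (\sum_i v i *: xi i) y.
  by rewrite mxdot_suml; apply: eq_bigr => i _; rewrite mxdotZl expr2.
have V2 : V ^+ 2 <= L * V * mxdot y y.
  rewrite {1}VE; apply: le_trans (mxdot_cauchy _ _) _.
  by rewrite ler_wpM2r ?mxdot_sq_ge0// H.
rewrite -/V; have [V0|V0] := eqVneq V 0; first by rewrite V0 mulr_ge0// mxdot_sq_ge0.
have Vp : 0 < V by rewrite lt_neqAle eq_sym V0 sum_sq_ge0.
by rewrite -(ler_pM2l Vp) -expr2 mulrCA mulrA.
Qed.

(** The gap is [(x - r * y) ^+ 2 / r]; the weight [r] stays free and is optimised at the very
    end. *)
Lemma sqrD_le_weighted (x y r : R) : 0 < r ->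
  (x + y) ^+ 2 <= (1 + r^-1) * x ^+ 2 + (1 + r) * y ^+ 2.
Proof.
move=> r0; rewrite -subr_ge0.
rewrite (_ : _ - _ = (x - r * y) ^+ 2 / r); last by field; rewrite gt_eqF.
by rewrite divr_ge0 ?sqr_ge0// ltW.
Qed.

(** The last hypothesis compares the lower and upper bounds on the objective value, divided by [p];
    [t] stands for the quadratic form of the solution at the spike, [b] for the square root of the
    signal strength. *)
Lemma spiked_quadratic_bound (g b t e : R) : 0 < g -> g <= 1 / 23 -> 0 <= b ->
  b ^+ 2 * g <= 1 -> 0 <= t -> t <= 1 -> e <= b * g ->
  (forall r, 0 < r -> 1 - g / 2 - 4 / 23 * e <=
    (1 + r^-1) * (2 * g ^+ 2 * (1 + b) ^+ 2) * t +
    (1 + r) * (1 + 9 * g) * (1 - t)) ->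
  t <= 23 * g * (1 + b).
Proof.
move=> g0 g1 b0 bg t0 t1 eb H.
pose G := g * (1 + b).
have gb0 : 0 <= g * b by rewrite mulr_ge0// ltW.
have gb : g * b <= 21 / 100.
  rewrite leNgt; apply/negP => h.
  have : (g * b) ^+ 2 <= g.
    rewrite (_ : (g * b) ^+ 2 = g * (b ^+ 2 * g)); last by ring.
    by rewrite ler_piMr// ltW.
  nra.
have G0 : 0 < G by rewrite mulr_gt0//; lra.
have G1 : G <= 254 / 1000 by rewrite /G mulrDr mulr1; lra.
pose tau := 2 * g ^+ 2 * (1 + b) ^+ 2.
have tauE : tau = 2 * G ^+ 2 by rewrite /tau /G; ring.
have tau0 : 0 < tau by rewrite tauE mulr_gt0// exprn_gt0.
have tau1 : tau <= 508 / 1000 * G by rewrite tauE; nra.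
(* The choice [r = 5 * tau] turns the term in [r^-1] into [t / 5]; as [tau <= 13 / 100], at least
   [67 / 100 * t] remains, against less than [14 * G]. *)
have := H (5 * tau); rewrite -/tau => /(_ ltac:(lra)).
rewrite (_ : (1 + (5 * tau)^-1) * tau * t = tau * t + t / 5); last first.
  by field; rewrite gt_eqF.
have e1 : (1 + 5 * tau) * (1 + 9 * g) * (1 - t) <=
    (1 + 9 * g) * (1 - t) + 5 * tau * (32 / 23).
  have : tau * ((1 + 9 * g) * (1 - t)) <= tau * (32 / 23).
    by rewrite ler_pM2l//; nra.
  lra.
have e2 : tau * t <= 130 / 1000 * t by rewrite ler_wpM2r//; lra.
have e3 : 0 <= g * t by rewrite mulr_ge0// ltW.
rewrite -mulrA -/G => h.
have GE : G = g + b * g by rewrite /G; ring.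
nra.
Qed.

End Sdp_bound.

Section Sdp_main.
Context {R : realType}.

Lemma mxform_le_trace p (X : 'M[R]_p) (z : 'cV[R]_p) :
  possemidef X -> unit_vector z -> mxform X z z <= \tr X.
Proof.
move=> /possemidef_sum_outer[s ->] z1.
rewrite (mxform_sum_outer s id) linear_sum/=; apply: ler_sum => y _.
rewrite mxtrace_outer; apply: le_trans (mxdot_cauchy _ _) _.
by rewrite [mxdot z z]z1 mul1r.
Qed.

Lemma sdp_quadratic_form_le (n p k : nat) (g b : R) (z : 'cV[R]_p)
    (u : 'I_n -> R) (xi : 'I_n -> 'cV[R]_p) (X : 'M[R]_p) :
  (0 < n)%N -> 0 < g -> g <= 1 / 23 -> g ^+ 2 * p%:R = n%:R ->
  0 <= b -> b ^+ 2 * g <= 1 -> unit_vector z ->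
  \sum_i u i ^+ 2 <= 2 * n%:R ->
  \sum_i mxdot (xi i) z ^+ 2 <= 2 * n%:R ->
  (forall i, p%:R * (1 - g / 2) <= mxdot (xi i) (xi i)) ->
  (forall v : 'I_n -> R, mxdot (\sum_i v i *: xi i) (\sum_i v i *: xi i) <=
     p%:R * (1 + 9 * g) * \sum_i v i ^+ 2) ->
  2 * p%:R / Num.sqrt n%:R <= k%:R :> R ->
  sdp_solution (sample_cov (fun i => (b * u i) *: z + xi i)) k X ->
  mxform X z z <= 23 * g * (1 + b).
Proof.
move=> n_gt0 g0 g1 gp b0 bg z1 hu hz hcol hop hk [[psdX trX _] Xmax].
have N0 : 0 < n%:R :> R by rewrite ltr0n.
have p0 : 0 < p%:R :> R.
  by rewrite lt_neqAle ler0n andbT; apply: contraTneq N0 => p0; rewrite -gp -p0 mulr0 ltxx.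
pose L := p%:R * (1 + 9 * g).
have L0 : 0 < L by rewrite mulr_gt0//; lra.
have dual : forall y, \sum_i mxdot (xi i) y ^+ 2 <= L * mxdot y y.
  by apply: op_norm_dual => //; exact: ltW.
pose x i := (b * u i) *: z + xi i.
pose S := sample_cov x.
have covE (I : Type) (s : seq I) (y : I -> 'cV[R]_p) :
    mxdot S (\sum_(a <- s) y a *m (y a)^T) =
    n%:R^-1 * \sum_(a <- s) \sum_i mxdot (x i) (y a) ^+ 2.
  rewrite /S /sample_cov mxdotZl mxdot_sumr; congr (_ * _).
  apply: eq_bigr => a _; rewrite mxdot_suml; apply: eq_bigr => i _.
  exact: mxdot_outer.
have [s XE] := possemidef_sum_outer psdX.
pose t := mxform X z z.
have tE : t = \sum_(y <- s) mxdot z y ^+ 2 by rewrite /t XE (mxform_sum_outer s id).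
have trE : \sum_(y <- s) mxdot y y = 1.
  by rewrite -trX XE linear_sum/=; apply: eq_bigr => y _; rewrite mxtrace_outer.
have t0 : 0 <= t by rewrite tE; apply: sumr_ge0 => y _; exact: sqr_ge0.
have t1 : t <= 1 by rewrite -trX; exact: mxform_le_trace.
(* The inner product of the sample [x i] with the unit vector [z]. *)
pose e i := b * u i + mxdot (xi i) z.
have se : \sum_i e i ^+ 2 <= 2 * n%:R * (1 + b) ^+ 2.
  (* Convexity with weights [b] and 1: the gap is [b * (u i - mxdot (xi i) z) ^+ 2]. *)
  apply: le_trans (_ : \sum_i (1 + b) * (b * u i ^+ 2 + mxdot (xi i) z ^+ 2) <= _).
    apply: ler_sum => i _; rewrite /e.
    have := mulr_ge0 b0 (sqr_ge0 (u i - mxdot (xi i) z)); lra.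
  rewrite -mulr_sumr big_split/= -mulr_sumr.
  have := ler_wpM2l b0 hu => hbu.
  have b1 : 0 <= 1 + b by lra.
  apply: le_trans (ler_wpM2l b1 (_ : _ <= b * (2 * n%:R) + 2 * n%:R)) _.
    exact: lerD.
  lra.
(* Each factor [y] of [X] is split into its part along [z] and an orthogonal remainder [y'], on
   which only the noise acts. *)
have upper r : 0 < r -> n%:R * mxdot S X <=
    (1 + r^-1) * (2 * n%:R * (1 + b) ^+ 2) * t + (1 + r) * L * (1 - t).
  move=> r0; have ri0 : 0 < r^-1 by rewrite invr_gt0.
  rewrite XE (covE _ s id) mulVKf ?gt_eqF//.
  have ub y : \sum_i mxdot (x i) y ^+ 2 <=
      (1 + r^-1) * (2 * n%:R * (1 + b) ^+ 2) * mxdot z y ^+ 2 +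
      (1 + r) * L * (mxdot y y - mxdot z y ^+ 2).
    pose c := mxdot z y; pose y' := y - c *: z.
    have y'E : mxdot y' y' = mxdot y y - c ^+ 2.
      rewrite /y' -scaleNr !mxdotDl !mxdotDr !mxdotZl !mxdotZr (mxdotC y z).
      by rewrite [mxdot z z]z1 -/c; ring.
    have xyE i : mxdot (x i) y = e i * c + mxdot (xi i) y'.
      rewrite /y' -scaleNr /x /e mxdotDl mxdotZl !mxdotDr mxdotZr -/c; ring.
    rewrite -/c -y'E.
    apply: le_trans (_ : \sum_i ((1 + r^-1) * (e i * c) ^+ 2 +
        (1 + r) * mxdot (xi i) y' ^+ 2) <= _).
      by apply: ler_sum => i _; rewrite xyE; exact: sqrD_le_weighted.
    rewrite big_split/= -!mulr_sumr; apply: lerD; last first.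
      by rewrite -mulrA ler_wpM2l//; lra.
    under eq_bigr => i _ do rewrite exprMn.
    rewrite -mulr_suml -mulrA ler_wpM2l//; first lra.
    by rewrite ler_wpM2r// sqr_ge0.
  apply: le_trans (ler_sum _ (fun y _ => ub y)) _.
  by rewrite big_split/= -!mulr_sumr -tE sumrB trE -tE.
(* [Phi] is the squared Frobenius norm of the noise matrix and the trace of [W], so [Phi^-1 *: W]
   has trace one. *)
pose Phi := \sum_i mxdot (xi i) (xi i).
have Phi_ge : n%:R * (p%:R * (1 - g / 2)) <= Phi.
  rewrite -[n in n%:R * _](card_ord n) mulr_natl -sumr_const.
  by apply: ler_sum => i _; exact: hcol.
have Phi0 : 0 < Phi.
  apply: lt_le_trans Phi_ge; rewrite !mulr_gt0//; lra.
pose W := \sum_i xi i *m (xi i)^T.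
have WW : mxdot W W <= L * Phi.
  rewrite {1}/W mxdot_suml /Phi mulr_sumr; apply: ler_sum => i _.
  rewrite /W mxdot_sumr; under eq_bigr => j _ do rewrite mxdot_outer mxdotC.
  exact: dual.
(* After squaring, the l1 constraint reduces to [L * n <= 4 * Phi]; the 4 is the square of the 2 in
   [hk]. *)
have feas : sdp_feasible k (Phi^-1 *: W).
  split.
  - apply: possemidefZ; first by rewrite invr_ge0 ltW.
    exact: possemidef_sum.
  - rewrite linearZ/= linear_sum/=; under eq_bigr => i _ do rewrite mxtrace_outer.
    by rewrite mulVf// gt_eqF.
  apply: le_trans hk.
  have sn : 0 < Num.sqrt (n%:R : R) by rewrite sqrtr_gt0.
  have normZ : mxnormS (Phi^-1 *: W) = Phi^-1 * mxnormS W.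
    rewrite /mxnormS mulr_sumr; apply: eq_bigr => i _.
    rewrite mulr_sumr; apply: eq_bigr => j _; rewrite mxE normrM ger0_norm//.
    by rewrite invr_ge0 ltW.
  rewrite normZ ler_pdivlMr// -mulrA ler_pdivrMl//.
  have nW0 : 0 <= mxnormS W by apply: sumr_ge0 => i _; apply: sumr_ge0.
  rewrite -(@ler_pXn2r _ 2)// ?nnegrE; [|by rewrite mulr_ge0// ltW|
    by rewrite mulr_ge0 ?(ltW Phi0)// mulr_ge0].
  rewrite exprMn sqr_sqrtr ?ler0n//.
  apply: le_trans (ler_wpM2r (ltW N0) (mxnormS_sq_le W)) _.
  apply: le_trans (_ : p%:R ^+ 2 * (L * Phi) * n%:R <= _).
    by rewrite ler_wpM2r// ler_wpM2l// sqr_ge0.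
  rewrite (_ : _ * n%:R = p%:R ^+ 2 * Phi * (L * n%:R)); last by ring.
  rewrite (_ : (Phi * _) ^+ 2 = p%:R ^+ 2 * Phi * (4 * Phi)); last by ring.
  rewrite ler_wpM2l//; first by rewrite mulr_ge0 ?sqr_ge0// ltW.
  apply: le_trans (_ : 4 * (n%:R * (p%:R * (1 - g / 2))) <= _); last lra.
  rewrite /L.
  have := mulr_gt0 N0 p0; nra.
(* Keeping the terms [a = i] of the double sum and applying Cauchy-Schwarz leaves [Q ^+ 2 / n],
   where [Q] differs from [Phi] only by the cross term between spike and noise. *)
have lower : p%:R * (1 - g / 2) - 4 * b <= n%:R * mxdot S X.
  apply: le_trans (_ : n%:R * mxdot S (Phi^-1 *: W) <= _); last first.
    by rewrite ler_pM2l//; exact: Xmax.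
  rewrite mxdotZr (covE _ _ xi) mulrCA mulVKf ?gt_eqF//.
  pose Q := \sum_i mxdot (x i) (xi i).
  have QE : Q = b * \sum_i u i * mxdot (xi i) z + Phi.
    rewrite mulr_sumr /Phi -big_split; apply: eq_bigr => i _ /=.
    by rewrite /x mxdotDl mxdotZl (mxdotC z) mulrA.
  have Quz : - (2 * n%:R) <= \sum_i u i * mxdot (xi i) z.
    have : 0 <= \sum_i (u i + mxdot (xi i) z) ^+ 2 by exact: sum_sq_ge0.
    rewrite (_ : \sum_i (u i + mxdot (xi i) z) ^+ 2 = \sum_i u i ^+ 2 +
        2 * \sum_i u i * mxdot (xi i) z + \sum_i mxdot (xi i) z ^+ 2); first lra.
    rewrite mulr_sumr -!big_split; apply: eq_bigr => i _ /=; ring.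
  have Q_ge : Phi - 2 * n%:R * b <= Q by rewrite QE; nra.
  have Q2 : Phi * (Phi - 4 * n%:R * b) <= Q ^+ 2.
    have c0 : 0 <= n%:R * b by rewrite mulr_ge0.
    have [h|h] := lerP 0 (Phi - 2 * n%:R * b); first by nra.
    by apply: le_trans (sqr_ge0 _); rewrite pmulr_rle0//; lra.
  have Qn : Q ^+ 2 <= n%:R * \sum_a \sum_i mxdot (x i) (xi a) ^+ 2.
    apply: le_trans (sqr_sum_le _) _; rewrite card_ord ler_wpM2l//.
    apply: ler_sum => i _; rewrite [leRHS](bigD1 i)//= lerDl.
    by apply: sumr_ge0 => j _; exact: sqr_ge0.
  rewrite ler_pdivlMl// -(ler_pM2l N0); apply: le_trans Qn; apply: le_trans Q2.
  rewrite mulrCA ler_pM2l// mulrBr; lra.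
apply: (@spiked_quadratic_bound _ g b t (b * g)) => // r r0.
rewrite -(ler_pM2l p0).
(* Here [p * g = n / g >= 23], so the cross-term loss [4 * b] is absorbed. *)
have low2 : 4 * b <= p%:R * (4 / 23 * (b * g)).
  have gN : 1 <= g ^+ 2 * p%:R by rewrite gp ler1n.
  have : 23 <= p%:R * g by nra.
  nra.
have := upper r r0; rewrite /L -gp => up.
apply: le_trans (_ : p%:R * (1 - g / 2) - 4 * b <= _); first lra.
rewrite gp in up; apply: le_trans lower _; apply: le_trans up _.
by rewrite -gp le_eqVlt; apply/orP; left; apply/eqP; ring.
Qed.

End Sdp_main.

(** * Eigenvalues of real symmetric matrices *)

Section Spectrum.
Context {R : realType}.

(** Over the complex numbers the matrix is Hermitian, hence unitarily diagonalisable with real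
    diagonal; eigenvalues descend to the reals through the characteristic polynomial. *)
Lemma symmetric_real_spectrum p (X : 'M[R]_p) : X^T = X ->
  exists d : 'I_p -> R, (forall i, eigenvalue X (d i)) /\ \tr X = \sum_i d i.
Proof.
move=> Xs; pose C : numClosedFieldType := complex R.
pose f : {rmorphism R -> C} := real_complex R.
pose XC := map_mx f X.
have XCreal : XC \is a mxOver Num.real.
  by apply/mxOverP => i j; rewrite mxE; apply/complex_realP; exists (X i j).
have XCherm : XC \is hermsymmx.
  apply: realsym_hermsym => //.
  by apply/is_hermitianmxP; rewrite expr0 scale1r; apply/matrixP => i j; rewrite !mxE -{1}Xs mxE.
have /orthomx_spectralP := hermitian_normalmx XCherm.
set P := spectralmx XC; set D := spectral_diag XC => XE.
have Pu : P \in unitmx := spectral_unit XC.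
have Dreal := hermitian_spectral_diag_real XCherm.
have /choice[d dE] i : exists x : R, D 0 i = f x.
  by apply/complex_realP; exact: (mxOverP Dreal).
exists d; split.
  move=> i; rewrite eigenvalue_root_char -(fmorph_root f) map_char_poly -/XC.
  rewrite -eigenvalue_root_char; apply/eigenvalueP; exists (row i P).
    rewrite -row_mul XE !mulmxA mulmxV// mul1mx mul_diag_mx.
    by apply/rowP => j; rewrite !mxE dE.
  apply/eqP => P0; have : row i (P *m invmx P) = 0 by rewrite row_mul P0 mul0mx.
  rewrite mulmxV// => /rowP/(_ i); rewrite !mxE eqxx => /eqP.
  by rewrite oner_eq0.
apply: (fmorph_inj f); rewrite -trace_map_mx -/XC XE mxtrace_mulC mulmxA mulmxV// mul1mx.
rewrite mxtrace_diag rmorph_sum; apply: eq_bigr => i _; exact: dE.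
Qed.

Lemma largest_eigenvalue_gt0 p (X : 'M[R]_p) l :
  X^T = X -> 0 < \tr X -> largest_eigenvalue X l -> 0 < l.
Proof.
move=> Xs + [_ lmax]; have [d [dX ->]] := symmetric_real_spectrum Xs.
apply: contraTT; rewrite -!leNgt => l0.
by apply: sumr_le0 => i _; apply: le_trans l0; exact: lmax.
Qed.

End Spectrum.

(** * Probability of the good event *)

Section Event.
Context {R : realType}.

(** Nonnegativity of the form at [z - a *: zh], with [a] the overlap, reads
    [l * a ^+ 2 <= mxform X z z]; positivity of [l] follows from the trace. *)
Lemma overlap_le p (X : 'M[R]_p) (l B : R) (zh z : 'cV[R]_p) :
  possemidef X -> \tr X = 1 -> largest_eigenvalue X l ->
  unit_vector zh -> X *m zh = l *: zh -> mxform X z z <= B ->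
  `|mxdot zh z| ^+ 2 <= B / l.
Proof.
move=> psdX trX lX zh1 zhE tB.
have l0 : 0 < l by apply: largest_eigenvalue_gt0 lX; [case: psdX|rewrite trX].
rewrite real_normK ?num_real// ler_pdivlMr//; apply: le_trans tB.
have [Xs X0] := psdX; pose a := mxdot zh z.
have := X0 (z - a *: zh); rewrite -/(mxform _ _ _) !mxform_mxdot.
rewrite -scaleNr mulmxDr -scalemxAr zhE !mxdotDl !mxdotDr !mxdotZl !mxdotZr.
have -> : mxdot zh (X *m z) = l * a.
  rewrite !mxdotE -mxtrace_tr trmx_mul trmxK trmx_mul Xs -mulmxA zhE.
  by rewrite -scalemxAr linearZ/= -mxdotE mxdotC.
by rewrite (mxdotC z zh) -/a [mxdot zh zh]zh1 => h; lra.
Qed.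

Definition failure_rate (n : nat) : R :=
  2 * expR (- (n%:R / 12)) + n%:R * expR (- (n%:R / 32)) +
  48 ^+ n * expR (- (4 * n%:R)).

(** The tail must beat the base 48 of the net count. Starting from [expR (1 / 32) >= 33 / 32], the
    powers taken multiply to 128. *)
Let exp4_ge : 49 <= expR 4 :> R.
Proof.
have h : 33 / 32 <= expR (1 / 32) :> R by have := expR_ge1Dx (1 / 32 : R); lra.
have h1 : 113 / 100 <= expR (1 / 32) ^+ 4 :> R.
  by apply: le_trans (lerXn2r 4 _ _ h); rewrite ?nnegrE ?expR_ge0//; lra.
have h2 : 163 / 100 <= (expR (1 / 32) ^+ 4) ^+ 4 :> R.
  by apply: le_trans (lerXn2r 4 _ _ h1); rewrite ?nnegrE ?exprn_ge0 ?expR_ge0//; lra.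
have h3 : 7 <= ((expR (1 / 32) ^+ 4) ^+ 4) ^+ 4 :> R.
  by apply: le_trans (lerXn2r 4 _ _ h2); rewrite ?nnegrE ?exprn_ge0 ?expR_ge0//; lra.
have h4 : 49 <= (((expR (1 / 32) ^+ 4) ^+ 4) ^+ 4) ^+ 2 :> R.
  by apply: le_trans (lerXn2r 2 _ _ h3); rewrite ?nnegrE ?exprn_ge0 ?expR_ge0//; lra.
apply: le_trans h4 _; rewrite -!exprM -expRM_natl ler_expR; lra.
Qed.

Lemma failure_rate_le n : (0 < n)%N -> failure_rate n <= 2120 / n%:R.
Proof.
move=> n0; have N0 : 0 < n%:R :> R by rewrite ltr0n.
have i0 : 0 < (n%:R : R)^-1 by rewrite invr_gt0.
have e1 : expR (- (n%:R / 12)) <= 12 / n%:R :> R.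
  rewrite expRN -[leRHS]invrK lef_pV2 ?posrE ?expR_gt0 ?invr_gt0 ?divr_gt0//.
  by rewrite invf_div; have := expR_ge1Dx (n%:R / 12 : R); lra.
have e2 : n%:R * expR (- (n%:R / 32)) <= 2048 / n%:R :> R.
  rewrite expRN ler_pdivrMr ?expR_gt0// mulrAC ler_pdivlMr//.
  have := @expR_ge1Dxn R (n%:R / 32) 1; rewrite divr_ge0 ?ler0n// => /(_ isT).
  by rewrite /factorial/=; lra.
have e3 : 48 ^+ n * expR (- (4 * n%:R)) <= 48 / n%:R :> R.
  rewrite expRN ler_pdivrMr ?expR_gt0// mulrAC ler_pdivlMr//.
  (* Bernoulli's inequality for [49 / 48], cleared of denominators. *)
  have h : (48 + n%:R) * 48 ^+ n <= 48 * 49 ^+ n :> R.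
    elim: (n) => [|m IH]; first by rewrite !expr0; lra.
    rewrite !exprS -[m.+1%:R]natr1.
    have : 0 <= 48 ^+ m :> R by rewrite exprn_ge0.
    move=> E0; have := mulr_ge0 (ler0n R m) E0; lra.
  have h49 : 49 ^+ n <= expR (4 * n%:R) :> R.
    by rewrite mulrC expRM_natl lerXn2r// ?nnegrE ?expR_ge0.
  have : 0 <= 48 ^+ n :> R by rewrite exprn_ge0.
  nra.
rewrite /failure_rate.
have -> : 2120 / n%:R = 2 * (12 / n%:R) + 2048 / n%:R + 48 / n%:R :> R by field; lra.
lra.
Qed.

End Event.

Section Main_event.
Context d (T : measurableType d) (R : realType) (P : probability T R).

Lemma spiked_sdp_event (n p k : nat) (beta : R) (z : 'cV[R]_p)
    (u : 'I_n -> {RV P >-> R}) (xi : 'I_n -> 'I_p -> {RV P >-> R}) :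
  (0 < n)%N -> gaussian_inputs u xi -> unit_vector z -> 0 < beta ->
  beta <= Num.sqrt (p%:R / n%:R) -> 2 * p%:R / Num.sqrt n%:R <= k%:R :> R ->
  exists E : set T, [/\ measurable E, ((1 - failure_rate n)%:E <= P E)%E &
    forall w, E w -> forall X,
      sdp_solution (spiked_cov beta z u xi w) k X ->
      mxform X z z <= 23 * Num.sqrt (n%:R / p%:R) * (1 + Num.sqrt beta)].
Proof.
move=> n_gt0 hinp z1 beta0 hbeta hk.
have N0 : 0 < n%:R :> R by rewrite ltr0n.
have p0 : 0 < p%:R :> R.
  rewrite ltr0n lt0n; apply/eqP => p0; move: z1; rewrite /unit_vector mxdot_col.
  rewrite big1 => [/eqP|i _]; first by rewrite eq_sym oner_eq0.
  by have := ltn_ord i; rewrite [in X in (_ < X)%N]p0.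
set g := Num.sqrt (n%:R / p%:R); set b := Num.sqrt beta.
have g0 : 0 < g by rewrite sqrtr_gt0 divr_gt0.
have b0 : 0 <= b by exact: sqrtr_ge0.
have rate0 : 0 <= failure_rate n :> R.
  by rewrite /failure_rate !addr_ge0 ?mulr_ge0 ?expR_ge0 ?exprn_ge0.
(* For [g > 1 / 23] the bound exceeds the trace 1, so the whole space serves as the event. *)
have [g1|g1] := lerP g (1 / 23); last first.
  exists setT; split => //.
    by rewrite probability_setT lee_fin; lra.
  move=> w _ X [[psdX trX _] _].
  have : mxform X z z <= 1 by rewrite -trX; exact: mxform_le_trace.
  by have := mulr_ge0 (ltW g0) b0; lra.
have gp : g ^+ 2 * p%:R = n%:R.
  by rewrite sqr_sqrtr ?divfK ?gt_eqF// divr_ge0// ltW.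
have bg : b ^+ 2 * g <= 1.
  rewrite sqr_sqrtr ?(ltW beta0)//.
  apply: le_trans (ler_wpM2r (ltW g0) hbeta) _.
  by rewrite -sqrtrM ?divr_ge0 ?(ltW p0) ?(ltW N0)// mulrA divfK ?gt_eqF// divff ?gt_eqF// sqrtr1.
(* Net points are normalised for the tail bound and rescaled afterwards by homogeneity. *)
pose K : finType := {m | m \in @integer_net R n}.
pose v (m : K) i : R := (net_coord (val m) i)%:~R / Num.sqrt (net_norm (val m)).
have netK (m : K) : 0 < net_norm (val m) :> R.
  by have := valP m; rewrite inE => /andP[].
have v1 m : \sum_i v m i ^+ 2 = 1.
  under eq_bigr => i _ do rewrite expr_div_n sqr_sqrtr ?(ltW (netK m))//.
  by rewrite -mulr_suml divff// gt_eqF// netK.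
have z1' : \sum_j z j 0 ^+ 2 = 1.
  by move: z1; rewrite /unit_vector mxdot_col => <-; apply: eq_bigr.
have g6 : g <= 1 / 6 by lra.
have [E [mE PE EP]] := gaussian_good_event hinp z1' v1 g0 g6 gp.
exists E; split => //.
  apply: le_trans PE; rewrite lee_fin /failure_rate.
  have -> : #|K| = #|@integer_net R n| by rewrite card_sig.
  have := ler_wpM2r (expR_ge0 (- (4 * n%:R))) (@card_integer_net R n); lra.
move=> w Ew X Xsol; have [hu hz hcol hnet] := EP w Ew.
pose x i : 'cV[R]_p := \col_j xi i j w.
apply: (@sdp_quadratic_form_le R n p k g b z (fun i => u i w) x X) => //.
- apply: le_trans hz; apply: ler_sum => i _; rewrite mxdot_col.
  by under eq_bigr => j _ do rewrite mxE mulrC.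
- move=> i; apply: le_trans (hcol i) _; rewrite mxdot_col.
  by under [leRHS]eq_bigr => j _ do rewrite !mxE -expr2.
move=> a; rewrite mxdot_col.
have -> : \sum_j (\sum_i a i *: x i) j 0 * (\sum_i a i *: x i) j 0 =
    \sum_j (\sum_i a i * xi i j w) ^+ 2.
  apply: eq_bigr => j _; rewrite -expr2 summxE; congr (_ ^+ 2).
  by apply: eq_bigr => i _; rewrite !mxE.
apply: (@op_norm_of_net R n p (fun i j => xi i j w) g g0 hcol) => m mnet.
have N1 : 0 < net_norm m :> R by exact: (netK (exist _ m mnet)).
have := hnet (exist _ m mnet); rewrite /v /=.
have -> : \sum_j (\sum_i (net_coord m i)%:~R / Num.sqrt (net_norm m) * xi i j w) ^+ 2 =
    (\sum_j (\sum_i (net_coord m i)%:~R * xi i j w) ^+ 2) / net_norm m.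
  rewrite mulr_suml; apply: eq_bigr => j _.
  rewrite -[X in _ / X](sqr_sqrtr (ltW N1)) -expr_div_n; congr (_ ^+ 2).
  by rewrite mulr_suml; apply: eq_bigr => i _; rewrite mulrAC.
by rewrite ler_pdivrMr.
Qed.

End Main_event.

Theorem theorem1p2 (R : realType) (c alpha : R) (p k : nat -> nat)
    (beta : nat -> R) (z : forall n, 'cV[R]_(p n))
    (d : nat -> measure_display) (T : forall n, measurableType (d n))
    (P : forall n, probability (T n) R)
    (u : forall n, 'I_n -> {RV (P n) >-> R})
    (xi : forall n, 'I_n -> 'I_(p n) -> {RV (P n) >-> R})
    (hspike : \forall n \near \oo, sparse_spike (k n) (z n))
    (hinputs : forall n, gaussian_inputs (u n) (xi n))
    (hc : 1 <= c) (halpha : 1 <= alpha)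
    (hp : p n @[n --> \oo] --> \oo)
    (hk : k n @[n --> \oo] --> \oo)
    (hpn : (p n)%:R / (n%:R `^ alpha) @[n --> \oo] --> c)
    (hbeta0 : \forall n \near \oo, 0 < beta n)
    (hbeta : \forall n \near \oo, beta n <= Num.sqrt ((p n)%:R / n%:R))
    (hkp : \forall n \near \oo, 2 * (p n)%:R / Num.sqrt (n%:R : R) <= (k n)%:R)
    (hkp0 : ((k n)%:R / (p n)%:R : R) @[n --> \oo] --> 0) :
  exists eps : nat -> R,
    eps n @[n --> \oo] --> 0 /\
    with_probability_tending_to_one P (fun n => [set w : T n |
      forall (X : 'M[R]_(p n)) (lambda1 : R) (zhat : 'cV[R]_(p n)),
        sdp_solution (spiked_cov (beta n) (z n) (u n) (xi n) w) (k n) X ->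
        largest_eigenvalue X lambda1 ->
        unit_vector zhat ->
        X *m zhat = lambda1 *: zhat ->
        `|mxdot zhat (z n)| ^+ 2 <=
          23 / lambda1 * Num.sqrt (n%:R / (p n)%:R) * (1 + Num.sqrt (beta n))
          + eps n / lambda1]).
Proof.
exists (fun=> 0); split; first exact: cvg_cst.
(* These conditions hold only for large [n]; elsewhere the empty event is taken, which leaves the
   limit unchanged. *)
pose good n := [/\ (0 < n)%N, unit_vector (z n), 0 < beta n,
  beta n <= Num.sqrt ((p n)%:R / n%:R) &
  2 * (p n)%:R / Num.sqrt (n%:R : R) <= (k n)%:R].
have good_near : \forall n \near \oo, good n.
  near=> n; split; near: n => //.
  - by apply: filterS hspike => n [].
match goal with |- with_probability_tending_to_one _ ?G' => set G := G' end.
have exE n : exists E : set (T n), [/\ measurable E, E `<=` G n &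
    good n -> ((1 - failure_rate n)%:E <= P n E)%E].
  have [[n0 zn b0 bn kn]|ngood] := pselect (good n); last by exists set0; split.
  have [E [mE PE EP]] := spiked_sdp_event n0 (hinputs n) zn b0 bn kn.
  exists E; split => // w Ew X l zh Xsol lX zh1 zhE.
  have [[psdX trX _] _] := Xsol.
  rewrite mul0r addr0.
  rewrite (_ : 23 / l * _ * _ = 23 * Num.sqrt (n%:R / (p n)%:R) *
    (1 + Num.sqrt (beta n)) / l); last by ring.
  exact: (overlap_le psdX trX lX zh1 zhE (EP w Ew X Xsol)).
pose E n := sval (cid (exE n)).
have EP n := svalP (cid (exE n)); rewrite -/(E _) in EP.
exists E; split; [by move=> n; case: (EP n)|by move=> n; case: (EP n)|].
have lim : (1 - 2120 / n%:R)%:E @[n --> \oo] --> (1 : R)%:E.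
  apply: cvg_EFin; first exact: nearW.
  rewrite -[X in _ --> X]subr0 -[X in _ --> _ - X](mulr0 2120).
  apply: cvgB; first exact: cvg_cst.
  apply: cvgMr; apply/gtr0_cvgV0; last exact: cvgr_idn.
  by near=> n; rewrite ltr0n; near: n; exact: nbhs_infty_gt.
apply: (squeeze_cvge _ lim (cvg_cst 1%E)).
near=> n; have n0 : (0 < n)%N by near: n; exact: nbhs_infty_gt.
have [_ _ PE] := EP n.
rewrite probability_le1; last by case: (EP n).
rewrite andbT; apply: le_trans (PE _); last by near: n.
by rewrite lee_fin; have := @failure_rate_le R n n0; lra.
Unshelve. all: by end_near.
Qed.
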